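(* Let $v\in\{1,\dots,d\}$, let $$S^v_{2,CVM}=\frac{\int_{\mathbb{R}^k}\mathbb{E}\left[(F(t)-F^v(t))^2\right]dF(t)}{\int_{\mathbb{R}^k}F(t)(1-F(t))\,dF(t)}$$ be the Cramér–von Mises index and let $\widehat S^v_{2,CVM}=\widehat N^v_{2,CVM}/\widehat D^v_{2,CVM}$ be its Pick and Freeze estimator defined in the context. Then, as $N\to\infty$, $\sqrt N\left(\widehat S^v_{2,CVM}-S^v_{2,CVM}\right)$ converges in distribution to a centered Gaussian law (with some finite variance).
   Context: Let $X=(X_1,\dots,X_d)$ be a vector of independent random inputs with values in $E_1\times\dots\times E_d$ and let $Z=f(X_1,\dots,X_d)\in\mathbb{R}^k$ with $f$ measurable. For $s,t\in\mathbb{R}^k$, $s\le t$ means $s_i\le t_i$ for all $i=1,\dots,k$. Let $F(t)=\mathbb{P}(Z\le t)$ and $F^v(t)=\mathbb{P}(Z\le t\mid X_v)$. Integration $dF(t)$ is integration with respect to the law of $Z$. The denominator $D^v_{2,CVM}=\int F(1-F)\,dF=\mathbb{E}[F(Z)(1-F(Z))]$ is assumed nonzero, so that the index is defined. Pick and Freeze pair: $Z^{v,1}=f(X)$ and $Z^{v,2}=f(X^v)$, where $X^v_v=X_v$ and, for $i\neq v$, $X^v_i=X'_i$ with $X'_i$ an independent copy of $X_i$ (all copies independent of each other and of $X$). Design: $(Z^{v,1}_j,Z^{v,2}_j)$, $j=1,2,\dots$, are i.i.d. copies of $(Z^{v,1},Z^{v,2})$, and $W_k$, $k=1,2,\dots$,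 are i.i.d. copies of $Z$, independent of the sequence $(Z^{v,1}_j,Z^{v,2}_j)_j$. The estimators of numerator and denominator are $$\widehat N^{v}_{2,CVM}=\frac1N\sum_{k=1}^N\left\{\frac1N\sum_{j=1}^N\mathbf 1_{\{Z^{v,1}_j\le W_k\}}\mathbf 1_{\{Z^{v,2}_j\le W_k\}}-\left[\frac1{2N}\sum_{j=1}^N\left(\mathbf 1_{\{Z^{v,1}_j\le W_k\}}+\mathbf 1_{\{Z^{v,2}_j\le W_k\}}\right)\right]^2\right\},$$ $$\widehat D^{v}_{2,CVM}=\frac1N\sum_{k=1}^N\left\{\frac1{2N}\sum_{j=1}^N\left(\mathbf 1_{\{Z^{v,1}_j\le W_k\}}+\mathbf 1_{\{Z^{v,2}_j\le W_k\}}\right)-\left[\frac1{2N}\sum_{j=1}^N\left(\mathbf 1_{\{Z^{v,1}_j\le W_k\}}+\mathbf 1_{\{Z^{v,2}_j\le W_k\}}\right)\right]^2\right\},$$ and $\widehat S^v_{2,CVM}=\widehat N^v_{2,CVM}/\widehat D^v_{2,CVM}$ (with an arbitrary fixed value when $\widehat D^v_{2,CVM}=0$). *)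

(* Defs.v *)
From HB Require Import structures.
From mathcomp Require Import all_boot all_order all_algebra finmap.
From mathcomp Require Import all_classical all_reals all_analysis.

Set Implicit Arguments.
Unset Strict Implicit.
Unset Printing Implicit Defensive.

Import Order.TTheory GRing.Theory Num.Theory.
Import numFieldNormedType.Exports.

Local Open Scope classical_set_scope.
Local Open Scope ring_scope.

Section random_elements.
Context {d : measure_display} {T : measurableType d} {R : realType}.
Variable P : probability T R.

Definition same_law d' (U : measurableType d') (X Y : T -> U) :=
  forall A : set U, measurable A -> P (X @^-1` A) = P (Y @^-1` A).

(* Mutual independence of the subfamily (X i)_{i in D}; the other members of
   the family are unconstrained. *)
Definition mutually_independent (I : choiceType) (D : set I)
    (dU : I -> measure_display) (U : forall i, measurableType (dU i))
    (X : forall i, T -> U i) :=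
  forall J : {fset I}, [set` J] `<=` D ->
  forall A : forall i, set (U i), (forall i, i \in J -> measurable (A i)) ->
  (P (\bigcap_(i in [set` J]) (X i @^-1` A i))
     = \prod_(i <- J) P (X i @^-1` A i))%E.

(* g is a version of the conditional probability P(A | X), that is, of
   E[1_A | sigma(X)]. *)
Definition is_cond_prob d' (U : measurableType d') (A : set T) (X : T -> U)
    (g : T -> R) :=
  [/\ measurable_fun [set: g_sigma_algebra_preimageType X] g,
      P.-integrable [set: T] (EFin \o g)
    & forall B, g_sigma_algebra_preimage X B ->
        (\int[P]_(w in B) (g w)%:E = P (A `&` B))%E].

Definition cvg_in_distribution (Y : nat -> T -> R)
    (mu : probability (measurableTypeR R) R) :=
  (forall n, measurable_fun [set: T] (Y n)) /\
  forall g : R -> R, continuous g -> (exists M : R, forall x, `|g x| <= M) ->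
  ('E_P[g \o Y n] @[n --> \oo] --> \int[mu]_x (g x)%:E)%E.

End random_elements.

Section generated_sigma_algebra.
Context {T : Type} {I : Type} {dU : I -> measure_display}.
Context {U : forall i, measurableType (dU i)}.

Definition family_events (X : forall i, T -> U i) : set (set T) :=
  \bigcup_i preimage_set_system setT (X i) measurable.

Definition family_sigma_algebra (X : forall i, T -> U i) : set (set T) :=
  <<s family_events X >>.

End generated_sigma_algebra.

Definition independent_families {d} {T : measurableType d} {R : realType}
    (P : probability T R)
    (I J : Type) (dU : I -> measure_display) (dV : J -> measure_display)
    (U : forall i, measurableType (dU i)) (V : forall j, measurableType (dV j))
    (X : forall i, T -> U i) (Y : forall j, T -> V j) :=
  forall A B, family_sigma_algebra X A -> family_sigma_algebra Y B ->
  (P (A `&` B) = P A * P B)%E.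

(* E_1 x ... x E_n with the product sigma-algebra. *)
Definition product_space n (dE : 'I_n -> measure_display)
    (E : forall i, measurableType (dE i)) :=
  g_sigma_algebraType (family_events (fun i (x : forall i, E i) => x i)).

(* normal_prob m s has mean m and standard deviation s, but for s = 0 the
   library makes it the uniform law on [0, 1]; the Gaussian law with variance 0
   is the Dirac mass. *)
Definition centered_gaussian {R : realType} (s : R) :
    probability (measurableTypeR R) R :=
  if s == 0 then (\d_(0 : measurableTypeR R) : probability (measurableTypeR R) R)
  else (normal_prob 0 s : probability (measurableTypeR R) R).

Section inputs.
Context {d : measure_display} {T : measurableType d} {n : nat}.
Context {dE : 'I_n -> measure_display} {E : forall i, measurableType (dE i)}.
Implicit Types X : forall i, {mfun T >-> E i}.

Definition input_index (ij : 'I_n + 'I_n) : 'I_n :=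
  match ij with inl i => i | inr i => i end.

Definition inputs_and_copies X X' (ij : 'I_n + 'I_n) :
    {mfun T >-> E (input_index ij)} :=
  match ij with inl i => X i | inr i => X' i end.

End inputs.

(* R^k is k.-tuple R, with its product (Borel) sigma-algebra. *)
Definition le_vec {R : realType} {k : nat} (s t : k.-tuple R) : bool :=
  [forall i, tnth s i <= tnth t i].

Definition ind_le {R : realType} {k : nat} (s t : k.-tuple R) : R :=
  (le_vec s t)%:R.

Section cramer_von_mises.
Context {d : measure_display} {T : measurableType d} {R : realType}.
Context {P : probability T R} {k : nat}.
Variable Z : {RV P >-> k.-tuple R}.

Definition joint_cdf (t : k.-tuple R) : R := fine (P [set w | le_vec (Z w) t]).

Definition cvm_denominator : R :=
  \int[distribution P Z]_t (joint_cdf t * (1 - joint_cdf t)).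

(* Fv t is meant to be a version of P(Z <= t | X_v); the expectation does not
   depend on the version. *)
Definition cvm_numerator (Fv : k.-tuple R -> T -> R) : R :=
  fine (\int[distribution P Z]_t
          'E_P[fun w => ((joint_cdf t - Fv t w) ^+ 2)%R])%E.

Definition cvm_index (Fv : k.-tuple R -> T -> R) : R :=
  cvm_numerator Fv / cvm_denominator.

End cramer_von_mises.

(* Indices run over 0, ..., N-1 instead of 1, ..., N. *)
Section estimators.
Context {T : Type} {R : realType} {k : nat}.
Variables (ZZ : nat -> T -> k.-tuple R * k.-tuple R) (W : nat -> T -> k.-tuple R).

Definition mean_products (N : nat) (w : T) (t : k.-tuple R) : R :=
  N%:R^-1 * \sum_(j < N) (ind_le (ZZ j w).1 t * ind_le (ZZ j w).2 t).

Definition pooled_cdf (N : nat) (w : T) (t : k.-tuple R) : R :=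
  (2 * N%:R)^-1 * \sum_(j < N) (ind_le (ZZ j w).1 t + ind_le (ZZ j w).2 t).

Definition cvm_num_estimator (N : nat) (w : T) : R :=
  N%:R^-1 * \sum_(l < N)
    (mean_products N w (W l w) - pooled_cdf N w (W l w) ^+ 2).

Definition cvm_den_estimator (N : nat) (w : T) : R :=
  N%:R^-1 * \sum_(l < N)
    (pooled_cdf N w (W l w) - pooled_cdf N w (W l w) ^+ 2).

Definition cvm_estimator (c : R) (N : nat) (w : T) : R :=
  if cvm_den_estimator N w == 0 then c
  else cvm_num_estimator N w / cvm_den_estimator N w.

End estimators.

(* Main.v *)
(* With S = N / D, the error sqrt n (N^ / D^ - S) equals sqrt n (N^ - S D^) / D^, and
   N^ - S D^ is a V-statistic of two samples. Its Hoeffding decomposition is a mean of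
   independent centered bounded variables plus a remainder which is doubly degenerate
   or quadratic in the error of the empirical distribution function; by orthogonality
   the remainder has first moment O(1/n), while D^ - D has second moment O(1/n). The
   linear part is handled by Lindeberg's exchange argument for test functions with a
   second order Taylor expansion with uniform cubic remainder, which yields the rate
   1 / sqrt n; smoothed steps of this kind suffice to test weak convergence.
   The limits of the estimators are identified with the index by conditioning on X_v:
   Z and Z^v are then independent with the same law, so that
   E[F^v(t)^2] = P(Z <= t, Z^v <= t). *)
Require Import Defs.
From HB Require Import structures.
From mathcomp Require Import all_boot all_order all_algebra finmap.
From mathcomp Require Import all_classical all_reals all_analysis.
From mathcomp Require Import measurable_realfun ring lra.

Set Implicit Arguments.
Unset Strict Implicit.
Unset Printing Implicit Defensive.

Import Order.TTheory GRing.Theory Num.Theory.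
Import numFieldNormedType.Exports.

Local Open Scope classical_set_scope.
Local Open Scope ring_scope.

(** The obstacle is the random denominator: the ratio is not itself a V-statistic, and it takes the
    arbitrary value [c] where the denominator vanishes. Test functions with values in [0, 1] that
    are also Lipschitz settle both points at once. The event that the denominator falls below
    [D / 2] costs only a Chebyshev bound. Elsewhere the error is a sum of terms of order 1 / sqrt n
    in mean, so no separate Slutsky argument appears. Kernels and test functions are bounded, so
    their means are finite reals; this is why [bmf] is carried throughout. No Gaussian variable is
    adjoined to the probability space: the exchange acts on the test function alone, through the
    semigroup law of Gaussian smoothing. Independence enters mostly in one form: when two
    sub-sigma-algebras are independent, the mean of h(w, w) may be computed with two sample points
    averaged separately. *)

Section bounded_measurable.
Context {R : realType}.

(** * Bounded measurable functions, their means, and Fubini's theorem for them *)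

Definition bmf d (T : measurableType d) (f : T -> R) :=
  measurable_fun [set: T] f /\ exists M, forall x, `|f x| <= M.

Section closure.
Context {d : measure_display} {T : measurableType d}.
Implicit Types f g : T -> R.

Lemma bmf_cst (r : R) : bmf (fun _ : T => r).
Proof. by split => //; exists `|r|. Qed.

Lemma bmfD f g : bmf f -> bmf g -> bmf (fun x => f x + g x).
Proof.
move=> [mf [M fM]] [mg [N gN]]; split; first exact: measurable_funD.
by exists (M + N) => x; rewrite (le_trans (ler_normD _ _))// lerD.
Qed.

Lemma bmfN f : bmf f -> bmf (fun x => - f x).
Proof.
move=> [mf [M fM]]; split; first exact: measurableT_comp.
by exists M => x; rewrite normrN.
Qed.

Lemma bmfB f g : bmf f -> bmf g -> bmf (fun x => f x - g x).
Proof. by move=> bf bg; apply: bmfD => //; exact: bmfN. Qed.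

Lemma bmfM f g : bmf f -> bmf g -> bmf (fun x => f x * g x).
Proof.
move=> [mf [M fM]] [mg [N gN]]; split; first exact: measurable_funM.
by exists (M * N) => x; rewrite normrM ler_pM.
Qed.

Lemma bmfX f n : bmf f -> bmf (fun x => f x ^+ n).
Proof.
move=> bf; elim: n => [|n IH].
  by under eq_fun do rewrite expr0; exact: bmf_cst.
by under eq_fun do rewrite exprS; exact: bmfM.
Qed.

Lemma bmf_norm f : bmf f -> bmf (fun x => `|f x|).
Proof.
move=> [mf [M fM]]; split; first exact: measurableT_comp.
by exists M => x; rewrite normr_id.
Qed.

Lemma bmf_sum (I : Type) (s : seq I) (p : pred I) (h : I -> T -> R) :
  (forall i, bmf (h i)) -> bmf (fun x => \sum_(i <- s | p i) h i x).
Proof.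
move=> bh; elim: s => [|i s IH].
  by under eq_fun do rewrite big_nil; exact: bmf_cst.
by under eq_fun do rewrite big_cons; case: (p i) => //; exact: bmfD.
Qed.

Lemma bmf_comp d' (U : measurableType d') (f : T -> R) (g : U -> T) :
  bmf f -> measurable_fun [set: U] g -> bmf (fun x => f (g x)).
Proof.
move=> [mf [M fM]] mg; split; first exact: measurableT_comp.
by exists M => x; exact: fM.
Qed.

Lemma bmf_integrable_lty (mu : {measure set T -> \bar R}) f :
  (mu [set: T] < +oo)%E -> bmf f -> mu.-integrable [set: T] (EFin \o f).
Proof.
move=> muT [mf [M fM]]; apply: measurable_bounded_integrable => //.
exists M; split; first exact: num_real.
by move=> y My x _; exact: le_trans (fM x) (ltW My).
Qed.

Lemma bmf_integrable (mu : probability T R) f :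
  bmf f -> mu.-integrable [set: T] (EFin \o f).
Proof.
apply: bmf_integrable_lty; apply: (@le_lt_trans _ _ 1%E); last exact: ltry.
exact: probability_le1.
Qed.

End closure.

Section mean.
Context {d : measure_display} {T : measurableType d} (P : probability T R).
Implicit Types f g : T -> R.

Definition mean f := \int[P]_x f x.

Lemma meanE f : bmf f -> (mean f)%:E = (\int[P]_x (f x)%:E)%E.
Proof.
move=> /(bmf_integrable P) bf; rewrite /mean /Rintegral fineK//.
exact: integrable_fin_num.
Qed.

Lemma eq_mean f g : f =1 g -> mean f = mean g.
Proof. by move=> /funext->. Qed.

Lemma mean_cst r : mean (fun _ => r) = r.
Proof.
rewrite /mean Rintegral_cst// [X in fine X](_ : _ = 1%E) ?mulr1//.
exact: probability_setT.
Qed.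

Lemma meanD f g : bmf f -> bmf g -> mean (fun x => f x + g x) = mean f + mean g.
Proof. by move=> bf bg; rewrite /mean RintegralD//; exact: bmf_integrable. Qed.

Lemma meanZ r f : bmf f -> mean (fun x => r * f x) = r * mean f.
Proof. by move=> bf; rewrite /mean RintegralZl//; exact: bmf_integrable. Qed.

Lemma meanN f : bmf f -> mean (fun x => - f x) = - mean f.
Proof.
by move=> bf; under eq_mean do rewrite -mulN1r; rewrite meanZ// mulN1r.
Qed.

Lemma meanB f g : bmf f -> bmf g -> mean (fun x => f x - g x) = mean f - mean g.
Proof. by move=> bf bg; rewrite meanD ?meanN//; exact: bmfN. Qed.

Lemma mean_sum (I : Type) (s : seq I) (p : pred I) (h : I -> T -> R) :
  (forall i, bmf (h i)) ->
  mean (fun x => \sum_(i <- s | p i) h i x) = \sum_(i <- s | p i) mean (h i).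
Proof.
move=> bh; elim: s => [|i s IH].
  by under eq_mean do rewrite big_nil; rewrite mean_cst big_nil.
under eq_mean do rewrite big_cons; rewrite big_cons.
by case: (p i) => //; rewrite meanD ?IH//; exact: bmf_sum.
Qed.

Lemma le_mean f g : bmf f -> bmf g -> (forall x, f x <= g x) ->
  mean f <= mean g.
Proof.
by move=> bf bg fg; apply: le_Rintegral => //; exact: bmf_integrable.
Qed.

Lemma mean_ge0 f : (forall x, 0 <= f x) -> 0 <= mean f.
Proof. by move=> f0; apply: Rintegral_ge0. Qed.

Lemma norm_mean f : bmf f -> `|mean f| <= mean (fun x => `|f x|).
Proof. by move=> bf; apply: le_normr_Rintegral => //; exact: bmf_integrable. Qed.

Lemma mean_le f M : bmf f -> (forall x, `|f x| <= M) -> `|mean f| <= M.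
Proof.
move=> bf fM; apply: (le_trans (norm_mean bf)).
rewrite -[leRHS]mean_cst; apply: le_mean => //; first exact: bmf_norm.
exact: bmf_cst.
Qed.

End mean.

Section sections.
Context {d1 d2 : measure_display} {T1 : measurableType d1}
  {T2 : measurableType d2}.
Variable h : T1 * T2 -> R.
Hypothesis bh : bmf h.

Lemma bmf_section1 x : bmf (fun y => h (x, y)).
Proof.
by apply: (@bmf_comp _ _ _ _ h (fun y => (x, y))) => //; exact: pair1_measurable.
Qed.

Lemma bmf_section2 y : bmf (fun x => h (x, y)).
Proof.
by apply: (@bmf_comp _ _ _ _ h (fun x => (x, y))) => //; exact: pair2_measurable.
Qed.

Lemma bmf_integrable_prod (P1 : probability T1 R) (P2 : probability T2 R) :
  (P1 \x P2)%E.-integrable setT (EFin \o h).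
Proof.
apply: bmf_integrable_lty => //.
suff e : (P1 \x P2)%E [set: T1 * T2] = 1%E by apply: le_lt_trans (ltry 1); rewrite -e.
rewrite -setXTT; apply: etrans (product_measure1E P1 P2 measurableT measurableT) _.
by rewrite -[RHS]mule1; congr mule; exact: probability_setT.
Qed.

Lemma bmf_mean (P2 : probability T2 R) :
  bmf (fun x => mean P2 (fun y => h (x, y))).
Proof.
have [_ [M hM]] := bh; split; last first.
  by exists M => x; apply: mean_le => //; exact: bmf_section1.
apply/measurable_EFinP.
(* Measurability of the inner integral is part of Fubini's theorem for a product measure. The inner
   integral involves [P2] only, so any probability can be the first factor; a Dirac mass is at
   hand. *)
have ih := bmf_integrable_prod (\d_(point : T1) : probability T1 R) P2.
apply: eq_measurable_fun (measurable_fubini_F ih).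
by move=> x _; rewrite /= meanE//; exact: bmf_section1.
Qed.

End sections.

Section fubini.
Context {d1 d2 : measure_display} {T1 : measurableType d1}
  {T2 : measurableType d2} (P1 : probability T1 R) (P2 : probability T2 R).
Variable h : T1 * T2 -> R.
Hypothesis bh : bmf h.

Let ih := bmf_integrable_prod bh P1 P2.

Lemma mean_prod : (\int[(P1 \x P2)%E]_z h z) =
  mean P1 (fun x => mean P2 (fun y => h (x, y))).
Proof.
apply: EFin_inj; rewrite meanE; last exact: bmf_mean.
rewrite /Rintegral fineK; last exact: integrable_fin_num.
rewrite -(integral12_prod_meas1 ih); apply: eq_integral => x _.
by rewrite meanE//; exact: bmf_section1.
Qed.

Lemma mean_prod' : (\int[(P1 \x P2)%E]_z h z) =
  mean P2 (fun y => mean P1 (fun x => h (x, y))).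
Proof.
have bG : bmf (fun y => mean P1 (fun x => h (x, y))).
  have [_ [M hM]] := bh; split; last first.
    by exists M => x; apply: mean_le => //; exact: bmf_section2.
  apply/measurable_EFinP; apply: eq_measurable_fun (measurable_fubini_G ih).
  by move=> x _; rewrite /= meanE//; exact: bmf_section2.
apply: EFin_inj; rewrite meanE//.
rewrite /Rintegral fineK; last exact: integrable_fin_num.
rewrite -(integral21_prod_meas1 ih); apply: eq_integral => x _.
by rewrite meanE//; exact: bmf_section2.
Qed.

Lemma mean_swap : mean P1 (fun x => mean P2 (fun y => h (x, y))) =
  mean P2 (fun y => mean P1 (fun x => h (x, y))).
Proof. by rewrite -mean_prod mean_prod'. Qed.

End fubini.

Section laws.
Context {d : measure_display} {T : measurableType d} (P : probability T R).

Lemma mean_pushforward d' (U : measurableType d') (X : {RV P >-> U}) (f : U -> R) :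
  bmf f -> mean (distribution P X) f = mean P (fun w => f (X w)).
Proof.
move=> bf; have bfX : bmf (fun w => f (X w)) by exact: bmf_comp.
apply: EFin_inj; rewrite !meanE//; rewrite integral_distribution//.
  exact/measurable_EFinP/bf.1.
exact: bmf_integrable.
Qed.

Lemma same_law_mean d' (U : measurableType d') (X Y : T -> U) (f : U -> R) :
  measurable_fun [set: T] X -> measurable_fun [set: T] Y -> same_law P X Y ->
  bmf f -> mean P (fun w => f (X w)) = mean P (fun w => f (Y w)).
Proof.
move=> mX mY XY bf.
pose X' : {RV P >-> U} := mfun_Sub (mem_set mX).
pose Y' : {RV P >-> U} := mfun_Sub (mem_set mY).
have := mean_pushforward X' bf; rewrite [RHS]/= => <-.
have := mean_pushforward Y' bf; rewrite [RHS]/= => <-.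
by rewrite /mean /Rintegral; congr fine; apply: eq_measure_integral => A mA _; exact: XY.
Qed.

End laws.
End bounded_measurable.

(** * Independence of generated sigma-algebras and decoupling *)

Section independence.
Context {R : realType} {d : measure_display} {T : measurableType d}.
Variable P : probability T R.
Implicit Types G : set (set T).

Definition independent_systems G1 G2 :=
  forall A B, G1 A -> G2 B -> P (A `&` B) = (P A * P B)%E.

Lemma independent_systems_sym G1 G2 :
  independent_systems G1 G2 -> independent_systems G2 G1.
Proof. by move=> i A B G2A G1B; rewrite setIC muleC i. Qed.

Let dynkin_independent B : measurable B ->
  dynkin [set A | measurable A /\ P (A `&` B) = (P A * P B)%E].
Proof.
move=> mB; split => /=.
- by split=> //; rewrite setTI probability_setT mul1e.
- move=> A [mA AB]; split; first exact: measurableC.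
  rewrite setIC -setDE measureD//; last first.
    by rewrite -ge0_fin_numE// fin_num_measure.
  rewrite probability_setC// (setIC B).
  transitivity (P B - P A * P B)%E; first by congr (_ - _)%E; exact: AB.
  rewrite muleBl ?mul1e ?fin_num_measure//.
- move=> F tF mF; split; first by apply: bigcup_measurable => n _; exact: (mF n).1.
  rewrite setI_bigcupl measure_semi_bigcup; last 3 first.
  + by move=> n; apply: measurableI => //; exact: (mF n).1.
  + exact: trivIset_setIr.
  + by apply: bigcup_measurable => n _; apply: measurableI => //; exact: (mF n).1.
  rewrite measure_semi_bigcup//; last 2 first.
  + by move=> n; exact: (mF n).1.
  + by apply: bigcup_measurable => n _; exact: (mF n).1.
  rewrite muleC -(fineK (fin_num_measure P B mB)) -nneseriesZl//.
  apply: eq_eseriesr => n _.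
  by rewrite fineK ?fin_num_measure// muleC; exact: (mF n).2.
Qed.

Let independent_systems_sigma1 G1 G2 : setI_closed G1 ->
  G1 `<=` measurable -> G2 `<=` measurable ->
  independent_systems G1 G2 -> independent_systems <<s G1 >> G2.
Proof.
move=> cG1 mG1 mG2 i A B; rewrite -setI_closed_g_dynkin_g_sigma_algebra// => GA G2B.
suff : <<d G1>> `<=` [set A | measurable A /\ P (A `&` B) = (P A * P B)%E].
  by move=> /(_ _ GA)[].
apply: smallest_sub; first exact: dynkin_independent (mG2 _ G2B).
by move=> C G1C; split; [exact: mG1|exact: i].
Qed.

(** Dynkin's pi-lambda argument, used on one side and then, after exchanging the roles, on the
    other: for a fixed [B], the product formula is stable under complements and disjoint countable
    unions. *)
Lemma independent_systems_sigma G1 G2 : setI_closed G1 -> setI_closed G2 ->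
  G1 `<=` measurable -> G2 `<=` measurable ->
  independent_systems G1 G2 -> independent_systems <<s G1 >> <<s G2 >>.
Proof.
move=> c1 c2 m1 m2 /(independent_systems_sigma1 c1 m1 m2) i.
apply: independent_systems_sym; apply: independent_systems_sigma1 => //.
  by apply: smallest_sub => //; exact: (@sigma_algebra_measurable _ T).
exact: independent_systems_sym.
Qed.

Section decouple.
Variables G1 G2 : set (set T).
Hypotheses (mG1 : <<s G1 >> `<=` measurable) (mG2 : <<s G2 >> `<=` measurable).
Hypothesis iG : independent_systems <<s G1 >> <<s G2 >>.
Local Notation T1 := (g_sigma_algebraType G1).
Local Notation T2 := (g_sigma_algebraType G2).

Let X1 : {mfun T >-> T1}.
Proof.
refine (mfun_Sub (f := idfun : T -> T1) (mem_set _)).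
by move=> _ Y mY; rewrite setTI; exact: mG1.
Defined.

Let X2 : {mfun T >-> T2}.
Proof.
refine (mfun_Sub (f := idfun : T -> T2) (mem_set _)).
by move=> _ Y mY; rewrite setTI; exact: mG2.
Defined.

Let X12 : {mfun T >-> (T1 * T2)%type}.
Proof.
refine (mfun_Sub (f := fun w => (X1 w, X2 w)) (mem_set _)).
exact: measurable_fun_pair.
Defined.

(** The space [T] is viewed as two measurable spaces, one for each sub-sigma-algebra, and the
    diagonal map w -> (w, w) as a random element of [T1 * T2]. Independence says exactly that its
    law agrees with the product of the two restrictions of [P] on rectangles, hence everywhere. In
    this form no function has to be factored through the variables generating the sigma-algebras. *)
Lemma decouple (h : T1 * T2 -> R) : bmf h ->
  mean P (fun w => h (w, w)) = mean P (fun w => mean P (fun w' => h (w, w'))).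
Proof.
move=> bh; rewrite (_ : (fun w => _) = (fun w => h (X12 w)))//.
rewrite -mean_pushforward//.
transitivity (\int[(distribution P X1 \x distribution P X2)%E]_z h z).
  rewrite /mean /Rintegral; congr fine.
  apply: eq_measure_integral => /= A mA _; apply/esym.
  by apply: product_measure_unique => // B C mB mC; exact: iG.
rewrite mean_prod//; have bm := bmf_mean bh (distribution P X2).
rewrite mean_pushforward//; apply: eq_mean => w.
by rewrite mean_pushforward//; exact: bmf_section1.
Qed.

Lemma decouple_comp d1 d2 (S1 : measurableType d1) (S2 : measurableType d2)
    (U : T -> S1) (V : T -> S2) (h : S1 * S2 -> R) :
  measurable_fun [set: T1] U -> measurable_fun [set: T2] V -> bmf h ->
  mean P (fun w => h (U w, V w)) =
  mean P (fun w => mean P (fun w' => h (U w, V w'))).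
Proof.
move=> mU mV bh.
have bUV : bmf (fun z : T1 * T2 => h (U z.1, V z.2)).
  by apply: bmf_comp => //; apply: measurable_fun_pair; exact: measurableT_comp.
exact: (decouple bUV).
Qed.

End decouple.
End independence.

(** Lets an event on one coordinate be written as a cylinder. The spaces [U j] depend on [j], so the
    given set has to be transported along the equality of indices. *)
Lemma measurable_family_at (I : Type) (dU : I -> measure_display)
    (U : forall i, measurableType (dU i)) i (Y : set (U i)) : measurable Y ->
  exists A : forall j, set (U j),
    [/\ forall j, measurable (A j), A i = Y & forall j, j <> i -> A j = setT].
Proof.
move=> mY; exists (fun j => match pselect (i = j) with
  | left e => eq_rect i (fun k => set (U k)) Y j e | right _ => setT end).
split=> [j||j ji].
- by case: pselect => [e|//]; case: j / e.
- by case: pselect => // e; rewrite (Prop_irrelevance e erefl).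
- by case: pselect => // ij; case: ji.
Qed.

Section families.
Context {R : realType} {d : measure_display} {T : measurableType d}.
Variable P : probability T R.
Context {I : choiceType} {dU : I -> measure_display}.
Context {U : forall i, measurableType (dU i)}.
Variable X : forall i, T -> U i.
Hypothesis mX : forall i, measurable_fun [set: T] (X i).
Implicit Types D : set I.

Definition subfamily_events D : set (set T) :=
  \bigcup_(i in D) preimage_set_system [set: T] (X i) measurable.

Lemma subfamily_eventsP D i : D i ->
  measurable_fun [set: g_sigma_algebraType (subfamily_events D)] (X i).
Proof.
move=> Di _ Y mY; rewrite setTI; apply: sub_sigma_algebra.
by exists i => //; exists Y => //; rewrite setTI.
Qed.

Lemma subfamily_events_measurable D : <<s subfamily_events D >> `<=` measurable.
Proof.
apply: smallest_sub; first exact: (@sigma_algebra_measurable _ T).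
by move=> _ [i Di [Y mY <-]]; exact: mX.
Qed.

(** The pi-system that generates the sigma-algebra of the subfamily and on which mutual independence
    is a plain product formula. *)
Let cylinders D : set (set T) := [set B | exists J : {fset I}, [set` J] `<=` D /\
  exists A : forall i, set (U i), (forall i, measurable (A i)) /\
    B = \bigcap_(i in [set` J]) (X i @^-1` A i)].

Let cylinders_setI D : setI_closed (cylinders D).
Proof.
move=> _ _ [J [JD [A [mA ->]]]] [K [KD [B [mB ->]]]].
exists (J `|` K)%fset; split.
  by move=> i /=; rewrite inE => /orP[/JD|/KD].
exists (fun i => (if i \in J then A i else setT) `&`
  (if i \in K then B i else setT)); split.
  by move=> i; apply: measurableI; case: ifP.
apply/seteqP; split=> w /=.
  by move=> [AJ BK] i /=; split; case: ifPn => // ik; [exact: AJ|exact: BK].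
move=> ABw; split=> i /= ik.
  by have [] := ABw i; rewrite /= ?inE ?ik.
by have [] := ABw i; rewrite /= ?inE ?ik ?orbT.
Qed.

Let cylinders_measurable D : cylinders D `<=` measurable.
Proof.
move=> _ [J [JD [A [mA ->]]]]; apply: fin_bigcap_measurable => //.
by move=> i _; rewrite -[X in measurable X]setTI; exact: mX.
Qed.

Let cylinders_sigma D : <<s subfamily_events D >> `<=` <<s cylinders D >>.
Proof.
apply: smallest_sub; first exact: smallest_sigma_algebra.
move=> _ [i Di [Y mY <-]]; apply: sub_sigma_algebra.
exists [fset i]%fset; split; first by move=> j /=; rewrite inE => /eqP ->.
have [A [mA Ai _]] := measurable_family_at mY.
exists A; split=> //.
rewrite setTI; apply/seteqP; split=> w /=.
  by move=> Yw j /=; rewrite inE => /eqP ->; rewrite Ai.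
by move=> /(_ i); rewrite /= inE eqxx Ai; exact.
Qed.

Lemma mutually_independent_sigma D D1 D2 : mutually_independent P D X ->
  D1 `<=` D -> D2 `<=` D -> D1 `&` D2 = set0 ->
  independent_systems P <<s subfamily_events D1 >> <<s subfamily_events D2 >>.
Proof.
move=> iX D1D D2D D12 A B /cylinders_sigma CA /cylinders_sigma CB.
apply: (@independent_systems_sigma _ _ _ P (cylinders D1) (cylinders D2)) => //.
move=> _ _ [J [JD [{CA}A [mA ->]]]] [K [KD [{CB}B [mB ->]]]].
have JK i : i \in J -> i \notin K.
  move=> iJ; apply/negP => iK; suff : (D1 `&` D2) i by rewrite D12.
  by split; [exact: JD|exact: KD].
(* The index sets [J] and [K] are disjoint, so one family [C] agrees with [A] on [J] and with [B] on
   [K]. The product formula over the union of [J] and [K] then splits into the two formulas. *)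
pose C i := if i \in J then A i else B i.
have CJ i : i \in J -> C i = A i by rewrite /C => ->.
have CK i : i \in K -> C i = B i.
  by move=> iK; rewrite /C; case: ifPn => // /JK; rewrite iK.
have -> : \bigcap_(i in [set` J]) (X i @^-1` A i) =
          \bigcap_(i in [set` J]) (X i @^-1` C i).
  by apply: eq_bigcapr => i /= /CJ ->.
have -> : \bigcap_(i in [set` K]) (X i @^-1` B i) =
          \bigcap_(i in [set` K]) (X i @^-1` C i).
  by apply: eq_bigcapr => i /= /CK ->.
have mC i : measurable (C i) by rewrite /C; case: ifP.
rewrite (iX J) ?(iX K)//; last 2 first.
- by move=> i /KD /D2D.
- by move=> i /JD /D1D.
rewrite -bigcap_setU (_ : [set` J] `|` [set` K] = [set` (J `|` K)%fset]); last first.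
  by apply/seteqP; split=> i /=; rewrite inE => /orP.
rewrite (iX (J `|` K)%fset)//; last first.
  by move=> i /=; rewrite inE => /orP[/JD /D1D|/KD /D2D].
rewrite (perm_big (J ++ K)) ?big_cat//=.
apply: uniq_perm; rewrite ?fset_uniq//.
  rewrite cat_uniq !fset_uniq andbT/=; apply/hasPn => i iK.
  by apply/negP => /JK; rewrite iK.
by move=> i; rewrite mem_cat inE.
Qed.

End families.

(** * Gaussian integrals: density, convolution, scaling, third moment *)

Section gaussian.
Context {R : realType}.
Local Notation mu := (@lebesgue_measure R).
Implicit Types (a b c s m k : R) (g : R -> R).

(** Change of variables holds for the Radon-Nikodym derivative. That derivative and [normal_pdf]
    have equal integrals over every measurable set, so they agree almost everywhere. *)
Lemma ge0_integral_normal_prob m s (f : R -> \bar R) :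
  measurable_fun [set: R] f -> (forall x, 0 <= f x)%E ->
  (\int[normal_prob m s]_x f x = \int[mu]_x (f x * (normal_pdf m s x)%:E))%E.
Proof.
move=> mf f0; have dom := normal_prob_dominates m s.
rewrite -(Radon_Nikodym_SigmaFinite.change_of_variables dom)//.
set h := Radon_Nikodym_SigmaFinite.f _ _.
have hi : mu.-integrable setT h by exact: Radon_Nikodym_SigmaFinite.f_integrable.
have mh : measurable_fun setT h := measurable_int _ hi.
have mp : measurable_fun setT (EFin \o normal_pdf m s).
  by apply/measurable_EFinP; exact: measurable_normal_pdf.
apply: ae_eq_integral => //; [exact: emeasurable_funM|exact: emeasurable_funM|].
apply: ae_eqe_mul2l; apply: integral_ae_eq => // A _ mA.
by rewrite -Radon_Nikodym_SigmaFinite.f_integral.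
Qed.

Lemma ge0_integral_affine (G : R -> R) k m : 0 < k -> continuous G ->
  (forall x, 0 <= G x) ->
  (\int[mu]_x (G x)%:E = \int[mu]_x (G (k * x + m) * k)%:E)%E.
Proof.
move=> k0 cG G0; pose F (x : R^o) : R^o := k * x + m.
have F' : F^`()%classic = cst k.
  apply/funext => x; rewrite /F derive1E deriveD// deriveM// !derive_cst.
  by rewrite derive_id scaler0 !addr0 /GRing.scale/= mulr1.
rewrite (@increasing_ge0_integration_by_substitutionT _ F G)//.
- by rewrite F'.
- by move=> x y xy; rewrite /F ltrD2r ltr_pM2l.
- by rewrite F' => x; exact: cvg_cst.
- by rewrite F'; exact: is_cvg_cst.
- by rewrite F'; exact: is_cvg_cst.
- apply: (@cvg_comp _ _ _ (fun x => k * x) (fun x => x + m) _ (ninfty_nbhs R)).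
    by apply/gt0_cvgMrNy.
  exact: cvg_addrr_Ny.
- apply: (@cvg_comp _ _ _ (fun x => k * x) (fun x => x + m) _ (pinfty_nbhs R)).
    by apply/gt0_cvgMry.
  exact: cvg_addrr.
Qed.

Lemma normal_peak_scale s : 0 < s -> normal_peak s = s^-1 * normal_peak 1.
Proof.
move=> s0; rewrite /normal_peak expr1n mul1r -mulrnAr sqrtrM ?sqr_ge0//.
by rewrite sqrtr_sqr gtr0_norm// invfM.
Qed.

Lemma normal_pdf_gt0E m s x : 0 < s ->
  normal_pdf m s x = s^-1 * normal_peak 1 * normal_fun m s x.
Proof. by move=> s0; rewrite normal_pdfE ?gt_eqF// normal_peak_scale. Qed.

(** Completing the square in x. For independent centered normals with deviations a and b, the joint
    density at first value x and sum s is the density of the sum times the conditional density of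
    the first value, which is normal with mean s a^2 / c^2 and deviation a b / c. *)
Lemma normal_pdf_mul a b c s x : 0 < a -> 0 < b -> 0 < c ->
  c ^+ 2 = a ^+ 2 + b ^+ 2 ->
  normal_pdf 0 b (s - x) * normal_pdf 0 a x =
  normal_pdf 0 c s * normal_pdf (s * a ^+ 2 / c ^+ 2) (a * b / c) x.
Proof.
move=> a0 b0 c0 cab.
have abc0 : 0 < a * b / c by rewrite divr_gt0// mulr_gt0.
rewrite !normal_pdf_gt0E// /normal_fun !subr0.
rewrite (_ : b^-1 * _ * _ * _ = (a * b)^-1 * normal_peak 1 ^+ 2 *
   (expR (- (s - x) ^+ 2 / (b ^+ 2 *+ 2)) * expR (- x ^+ 2 / (a ^+ 2 *+ 2)))); last first.
  by rewrite invfM expr2; ring.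
rewrite (_ : c^-1 * _ * _ * _ = (a * b)^-1 * normal_peak 1 ^+ 2 *
   (expR (- s ^+ 2 / (c ^+ 2 *+ 2)) *
    expR (- (x - s * a ^+ 2 / c ^+ 2) ^+ 2 / ((a * b / c) ^+ 2 *+ 2)))); last first.
  by rewrite expr2; field; rewrite !gt_eqF.
congr (_ * _); rewrite -!expRD; congr expR.
rewrite !exprMn exprVn cab -[_ *+ 2]mulr_natr -[a ^+ 2 *+ 2]mulr_natr.
rewrite -[(_ + _) *+ 2]mulr_natr -[(_ * _) *+ 2]mulr_natr.
field; rewrite !gt_eqF//; nra.
Qed.

Let integral_normal_shift b x g : 0 < b -> continuous g -> (forall x, 0 <= g x) ->
  (\int[normal_prob 0 b]_y (g (x + y))%:E =
   \int[mu]_s (g s * normal_pdf 0 b (s - x))%:E)%E.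
Proof.
move=> b0 cg g0; rewrite ge0_integral_normal_prob//; last 2 first.
- apply/measurable_EFinP; apply: measurableT_comp; last exact: measurable_funD.
  exact: continuous_measurable_fun.
- by move=> y; rewrite lee_fin.
rewrite [RHS](@ge0_integral_affine _ 1 x)//.
- by apply: eq_integral => y _; rewrite mulr1 mul1r addrK (addrC x).
- move=> y; apply: cvgM; first exact: cg.
  apply: (cvg_comp (fun z => z - x) (normal_pdf 0 b)).
    by apply: (@cvgB _ R^o) => //; [exact: cvg_id|exact: cvg_cst].
  by apply: continuous_normal_pdf; rewrite gt_eqF.
- by move=> y; rewrite mulr_ge0// normal_pdf_ge0.
Qed.

(** With the sum s = x + y as inner variable, Tonelli's theorem puts the integral over s outside,
    and [normal_pdf_mul] leaves a conditional density in x, which integrates to 1. Nonnegativity of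
    [g] is what permits Tonelli. *)
Lemma normal_prob_convolution a b c g : 0 < a -> 0 < b -> 0 < c ->
  c ^+ 2 = a ^+ 2 + b ^+ 2 -> continuous g -> (forall x, 0 <= g x) ->
  (\int[normal_prob 0 a]_x \int[normal_prob 0 b]_y (g (x + y))%:E =
   \int[normal_prob 0 c]_x (g x)%:E)%E.
Proof.
move=> a0 b0 c0 cab cg g0.
have mg : measurable_fun [set: R] g by exact: continuous_measurable_fun.
under eq_integral do rewrite integral_normal_shift//.
pose h (z : measurableTypeR R * measurableTypeR R) : \bar R :=
  (g z.2 * normal_pdf 0 b (z.2 - z.1))%:E.
pose h' (z : measurableTypeR R * measurableTypeR R) : \bar R :=
  (g z.2 * (normal_pdf 0 b (z.2 - z.1) * normal_pdf 0 a z.1))%:E.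
have mb : measurable_fun setT (fun z : measurableTypeR R * measurableTypeR R =>
    normal_pdf 0 b (z.2 - z.1)).
  apply: measurableT_comp; first exact: measurable_normal_pdf.
  by apply: measurable_funB; [exact: measurable_snd|exact: measurable_fst].
have mg2 : measurable_fun setT (fun z : measurableTypeR R * measurableTypeR R => g z.2).
  by apply: measurableT_comp => //; exact: measurable_snd.
have mh : measurable_fun setT h by apply/measurable_EFinP/measurable_funM.
have mh' : measurable_fun setT h'.
  apply/measurable_EFinP/measurable_funM => //; apply: measurable_funM => //.
  by apply: measurableT_comp; [exact: measurable_normal_pdf|exact: measurable_fst].
have h0 z : (0 <= h z)%E by rewrite lee_fin mulr_ge0// normal_pdf_ge0.
have h'0 z : (0 <= h' z)%E by rewrite lee_fin !mulr_ge0// normal_pdf_ge0.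
rewrite [LHS]ge0_integral_normal_prob//; last 2 first.
- exact: (@measurable_fun_fubini_tonelli_F _ _ _ _ _ mu h).
- by move=> x; apply: integral_ge0 => y _; exact: (h0 (x, y)).
transitivity (\int[mu]_x \int[mu]_y h' (x, y))%E.
  apply: eq_integral => x _; rewrite -ge0_integralZr//; last 3 first.
  - exact: measurableT_comp mh (pair1_measurable x).
  - by move=> y _; exact: (h0 (x, y)).
  - by rewrite lee_fin normal_pdf_ge0.
  by apply: eq_integral => y _; rewrite /h' /= -EFinM -mulrA.
rewrite fubini_tonelli// [RHS]ge0_integral_normal_prob//; last exact/measurable_EFinP.
apply: eq_integral => s _; rewrite /h'/=.
under eq_integral do rewrite (normal_pdf_mul _ _ a0 b0 c0 cab) mulrA EFinM.
rewrite ge0_integralZl//.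
- by rewrite integral_normal_pdf mule1.
- by apply/measurable_EFinP; exact: measurable_normal_pdf.
- by move=> x _; rewrite lee_fin normal_pdf_ge0.
- by rewrite lee_fin mulr_ge0// normal_pdf_ge0.
Qed.

Lemma normal_prob_scale s g : 0 < s -> continuous g -> (forall x, 0 <= g x) ->
  (\int[normal_prob 0 s]_x (g x)%:E = \int[normal_prob 0 1]_x (g (s * x))%:E)%E.
Proof.
move=> s0 cg g0.
have mg : measurable_fun [set: R] g by exact: continuous_measurable_fun.
rewrite [LHS]ge0_integral_normal_prob//; last exact/measurable_EFinP.
rewrite [RHS]ge0_integral_normal_prob; last 2 first.
- by apply/measurable_EFinP; exact: measurableT_comp.
- by move=> x; rewrite lee_fin.
under eq_integral do rewrite -EFinM.
rewrite (@ge0_integral_affine _ s 0)//; last 2 first.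
- move=> y; apply: cvgM; first exact: cg.
  by apply: continuous_normal_pdf; rewrite gt_eqF.
- by move=> y; rewrite mulr_ge0// normal_pdf_ge0.
apply: eq_integral => y _; rewrite addr0 -EFinM -mulrA; congr (_ * _)%:E.
rewrite !normal_pdf_gt0E// invr1 mul1r mulrC !mulrA mulfV ?gt_eqF// mul1r.
congr (_ * _); rewrite /normal_fun !subr0 exprMn expr1n; congr expR.
by rewrite -[s ^+ 2 *+ 2]mulr_natr; field; rewrite gt_eqF.
Qed.

Lemma integrable_normal_prob_cube :
  (normal_prob 0 1).-integrable [set: R] (fun x => (`|x| ^+ 3)%:E).
Proof.
have mf : measurable_fun [set: R] (fun x : R => (`|x| ^+ 3)%:E).
  by apply/measurable_EFinP; apply: measurable_funX; exact: normr_measurable.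
apply/integrableP; split => //.
under eq_integral do rewrite gee0_abs ?lee_fin ?exprn_ge0//.
rewrite ge0_integral_normal_prob//.
(* The cube is absorbed by passing from deviation 1 to deviation 2, which frees a factor exp(- 3 x^2
   / 8). The factor 2 compensates the peak at deviation 2. The number 33 is large enough that 33 (1
   + (3 y^2 / 8)^2 / 2) >= y^3, where the bracket bounds exp(3 y^2 / 8) from below. *)
pose C : R := 33 * 2.
apply: (@le_lt_trans _ _ (\int[mu]_x (C%:E * (normal_pdf 0 2 x)%:E))%E).
  apply: ge0_le_integral => //.
  - by move=> x _; rewrite mule_ge0// lee_fin ?exprn_ge0// normal_pdf_ge0.
  - apply: emeasurable_funM => //; apply/measurable_EFinP.
    exact: measurable_normal_pdf.
  - apply: emeasurable_funM => //; apply/measurable_EFinP.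
    exact: measurable_normal_pdf.
  move=> x _; rewrite -!EFinM lee_fin !normal_pdf_gt0E// /normal_fun !subr0.
  rewrite invr1 mul1r (_ : - x ^+ 2 / (1 ^+ 2 *+ 2) =
    - x ^+ 2 / (2 ^+ 2 *+ 2) - 3 / 8 * x ^+ 2); last by field.
  rewrite expRD [leLHS]mulrCA [leRHS](_ : _ = normal_peak 1 * (33 *
    expR (- x ^+ 2 / (2 ^+ 2 *+ 2)))); last by rewrite /C; field.
  rewrite ler_wpM2l ?normal_peak_ge0// mulrCA [leRHS]mulrC.
  rewrite ler_wpM2l ?expR_ge0// expRN ler_pdivrMr ?expR_gt0//.
  have := @expR_ge1Dxn R (3 / 8 * x ^+ 2) 1 _.
  have -> : (2`!)%:R = 2 :> R by [].
  have x2 : x ^+ 2 = `|x| ^+ 2 by rewrite real_normK ?num_real.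
  rewrite x2; have x0 := normr_ge0 x.
  have -> : 0 <= 3 / 8 * `|x| ^+ 2 :> R by rewrite mulr_ge0 ?sqr_ge0//; lra.
  move=> /(_ isT); set E := expR _; set y := `|x|.
  move=> h; rewrite (le_trans (y := 33 * (1 + (3 / 8 * y ^+ 2) ^+ 2 / 2)))//.
    by have := sqr_ge0 (y ^+ 2 - y / 2); have := sqr_ge0 (y ^+ 2 - 1); nra.
  by rewrite ler_wpM2l.
rewrite ge0_integralZl//.
- by rewrite integral_normal_pdf mule1 ltry.
- by apply/measurable_EFinP; exact: measurable_normal_pdf.
- by move=> x _; rewrite lee_fin normal_pdf_ge0.
- by rewrite lee_fin /C; lra.
Qed.

End gaussian.

(** * Test functions with a uniform second order expansion, and smooth steps *)

Section taylor.
Context {R : realType}.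
Implicit Types (g u : R -> R) (K : R).

(* The quadratic coefficient [g2] stands for [g'' / 2]. *)
Definition taylor2 K g g1 g2 := forall x y,
  `|g (x + y) - g x - y * g1 x - y ^+ 2 * g2 x| <= K * `|y| ^+ 3.

(** The coefficients are asked to be measurable rather than to be derivatives: they only need to be
    averaged against a Gaussian, and averaging the expansion keeps the same constant [K]. *)
Definition smooth K g := exists g1 g2 : R -> R, [/\ measurable_fun [set: R] g1,
  measurable_fun [set: R] g2 & taylor2 K g g1 g2].

Lemma taylor2_ge0 K g g1 g2 : taylor2 K g g1 g2 -> 0 <= K.
Proof.
by move=> /(_ 0 1); rewrite normr1 !expr1n mulr1; exact/le_trans/normr_ge0.
Qed.

(** The difference and the sum of the expansions with increments 1 and -1 isolate [g1 x] and
    [g2 x]. *)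
Lemma taylor2_bounded K g g1 g2 M : (forall x, `|g x| <= M) ->
  taylor2 K g g1 g2 ->
  (forall x, `|g1 x| <= 2 * M + K) /\ (forall x, `|g2 x| <= 2 * M + K).
Proof.
move=> gM t; suff H x : `|g1 x| <= 2 * M + K /\ `|g2 x| <= 2 * M + K.
  by split => x; have [] := H x.
have := t x 1; have := t x (-1); have := gM (x + 1); have := gM x.
have := gM (x - 1); rewrite normrN normr1 sqrrN !expr1n mulr1 !ler_norml.
by do 5!(move=> /andP[? ?]); split; apply/andP; split; lra.
Qed.

(** Up to distance 1 the expansion with bounded coefficients gives the constant 4 M + 3 K; beyond
    distance 1 the bound 2 M on the oscillation suffices. The stated constant exceeds both. *)
Lemma taylor2_lipschitz K g g1 g2 M : (forall x, `|g x| <= M) ->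
  taylor2 K g g1 g2 ->
  forall x y, `|g y - g x| <= (6 * M + 4 * K) * `|y - x|.
Proof.
move=> gM t x y; have K0 := taylor2_ge0 t; have [b1 b2] := taylor2_bounded gM t.
have M0 : 0 <= M := le_trans (normr_ge0 _) (gM 0).
have [yx|yx] := leP `|y - x| 1.
  have := t x (y - x); rewrite (addrC x) subrK => tyx.
  rewrite (_ : g y - g x = (g y - g x - (y - x) * g1 x - (y - x) ^+ 2 * g2 x) +
    (y - x) * g1 x + (y - x) ^+ 2 * g2 x); last by ring.
  set z := `|y - x| in yx tyx *; have z0 : 0 <= z by exact: normr_ge0.
  have n1 : `|(y - x) * g1 x| <= z * (2 * M + K) by rewrite normrM ler_wpM2l.
  have n2 : `|(y - x) ^+ 2 * g2 x| <= z ^+ 2 * (2 * M + K).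
    by rewrite normrM normrX ler_wpM2l// exprn_ge0.
  rewrite (le_trans (ler_normD _ _))//.
  rewrite (le_trans (lerD (ler_normD _ _) (lexx _)))//.
  rewrite (le_trans (lerD (lerD tyx n1) n2))//.
  have z2 : z ^+ 2 <= z by rewrite expr2 ler_piMr.
  have z3 : z ^+ 3 <= z by rewrite exprS (le_trans _ z2)// ler_wpM2l.
  have : z ^+ 2 * (2 * M + K) <= z * (2 * M + K) by rewrite ler_wpM2r//; lra.
  have : K * z ^+ 3 <= K * z by rewrite ler_wpM2l.
  by have := mulr_ge0 M0 z0; have := mulr_ge0 K0 z0; nra.
rewrite (le_trans (ler_normB _ _))// (le_trans (lerD (gM _) (gM _)))//.
have Mz : M <= M * `|y - x| by rewrite ler_peMr// ltW.
by have := mulr_ge0 K0 (normr_ge0 (y - x)); nra.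
Qed.

Lemma lipschitz_continuous g (L : R) :
  (forall x y, `|g y - g x| <= L * `|y - x|) -> continuous g.
Proof.
move=> gL x; apply/(@cvgrPdist_le _ R^o) => e e0; near=> y.
rewrite distrC (le_trans (gL _ _))//.
rewrite (@le_trans _ _ ((`|L| + 1) * `|y - x|))//.
  by rewrite ler_wpM2r// (le_trans (ler_norm _))// lerDl.
rewrite mulrC -ler_pdivlMr ?ltr_pwDr// distrC.
near: y; apply: (@cvgr_dist_le _ R^o _ _ _ id); first exact: cvg_id.
by rewrite divr_gt0// ltr_pwDr.
Unshelve. all: by end_near. Qed.

Lemma smooth_continuous K g : bmf g -> smooth K g -> continuous g.
Proof.
move=> [_ [M gM]] [g1 [g2 [_ _ t]]].
exact: lipschitz_continuous (taylor2_lipschitz gM t).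
Qed.

Lemma smoothD K L g u : smooth K g -> smooth L u ->
  smooth (K + L) (fun x => g x + u x).
Proof.
move=> [g1 [g2 [mg1 mg2 tg]]] [u1 [u2 [mu1 mu2 tu]]].
exists (fun x => g1 x + u1 x), (fun x => g2 x + u2 x); split.
- exact: measurable_funD.
- exact: measurable_funD.
move=> x y; rewrite mulrDl (le_trans _ (lerD (tg x y) (tu x y)))//.
by rewrite (le_trans _ (ler_normD _ _))// le_eqVlt; apply/orP; left; apply/eqP;
  congr `|_|; ring.
Qed.

Lemma smoothZ K g (r : R) : smooth K g -> smooth (`|r| * K) (fun x => r * g x).
Proof.
move=> [g1 [g2 [mg1 mg2 tg]]].
exists (fun x => r * g1 x), (fun x => r * g2 x); split.
- exact: measurable_funM.
- exact: measurable_funM.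
move=> x y; rewrite -[leRHS]mulrA (le_trans _ (ler_wpM2l (normr_ge0 r) (tg x y)))//.
by rewrite -normrM le_eqVlt; apply/orP; left; apply/eqP; congr `|_|; ring.
Qed.

Lemma smooth_affine K g (k l : R) : smooth K g ->
  smooth (K * `|k| ^+ 3) (fun x => g (k * x + l)).
Proof.
move=> [g1 [g2 [mg1 mg2 tg]]].
exists (fun x => k * g1 (k * x + l)), (fun x => k ^+ 2 * g2 (k * x + l)).
have ma : measurable_fun [set: R] (fun x => k * x + l).
  by apply: measurable_funD => //; exact: measurable_funM.
split.
- by apply: measurable_funM => //; exact: measurableT_comp.
- by apply: measurable_funM => //; exact: measurableT_comp.
move=> x y; rewrite [leRHS](_ : _ = K * `|k * y| ^+ 3); last first.
  by rewrite normrM; ring.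
apply: le_trans (tg (k * x + l) (k * y)).
rewrite le_eqVlt; apply/orP; left; apply/eqP; congr `|_|.
by rewrite (_ : k * x + l + k * y = k * (x + y) + l); ring.
Qed.

(** The truncated power that generates cubic splines: its second derivative is piecewise linear,
    which is just the regularity that [taylor2] asks for. *)
Let cube_pos (x : R) : R := (Num.max x 0) ^+ 3.

Let smooth_cube_pos : smooth 1 cube_pos.
Proof.
exists (fun x => 3 * Num.max x 0 ^+ 2), (fun x => 3 * Num.max x 0).
have mm : measurable_fun [set: R] (fun x : R => Num.max x 0).
  exact: measurable_maxr.
split.
- by apply: measurable_funM => //; exact: measurable_funX.
- exact: measurable_funM.
move=> x y; rewrite mul1r /cube_pos.
have [y0|y0] := ler0P y; have [x0|x0] := leP x 0; have [xy|xy] := leP (x + y) 0;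
  rewrite ler_norml; apply/andP; split; try lra.
all: try (move: x y y0 x0 xy; clear; move=> *; nra).
(* What is left is the case where x and x + y lie on opposite sides of 0. On the same side the
   remainder is exactly y^3 or 0. *)
- have : 0 <= (- (x + y)) ^+ 3 by rewrite exprn_ge0//; lra.
  by nra.
- have : (- (x + y)) ^+ 3 <= (- y) ^+ 3 by rewrite lerXn2r ?nnegrE//; lra.
  have : 0 <= (- y) ^+ 3 by rewrite exprn_ge0//; lra.
  by nra.
- have : 0 <= (x + y) ^+ 3 by rewrite exprn_ge0//; lra.
  have : 0 <= y ^+ 3 by rewrite exprn_ge0//; lra.
  by nra.
- have : (x + y) ^+ 3 <= y ^+ 3 by rewrite lerXn2r ?nnegrE//; lra.
  by nra.
Qed.

(* The third difference of the cubic truncated power: a C^2 step from 0 to 1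
   on [0, 3]. *)
Definition step (x : R) : R := 6^-1 * (cube_pos x - 3 * cube_pos (x - 1) +
  3 * cube_pos (x - 2) - cube_pos (x - 3)).

Lemma step_le0 x : x <= 0 -> step x = 0.
Proof.
move=> x0; rewrite /step /cube_pos !(max_idPr _); [|lra..].
by rewrite expr0n/=; ring.
Qed.

Lemma step_ge3 x : 3 <= x -> step x = 1.
Proof.
move=> x3; rewrite /step /cube_pos !(max_idPl _); [|lra..].
by field.
Qed.

Lemma step_itv x : 0 <= step x <= 1.
Proof.
have [x0|x0] := leP x 0; first by rewrite step_le0// lexx ler01.
have [x3|x3] := leP 3 x; first by rewrite step_ge3// lexx ler01.
have m3 : Num.max (x - 3) 0 = 0 by apply/max_idPr; lra.
rewrite /step /cube_pos (max_idPl (ltW x0)) m3.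
rewrite expr0n/= subr0; have [x1|x1] := leP (x - 1) 0.
  have -> : Num.max (x - 2) 0 = 0 by apply/max_idPr; lra.
  have x30 : 0 <= x ^+ 3 by rewrite exprn_ge0// ltW.
  have : x ^+ 3 <= 1 by rewrite exprn_ile1//; lra.
  by rewrite expr0n/= => ?; apply/andP; split; nra.
have [x2|x2] := leP (x - 2) 0.
  rewrite expr0n/=; pose v := x - 1; have -> : x = v + 1 by rewrite /v subrK.
  have v0 : 0 <= v by rewrite /v; lra.
  have v1 : v <= 1 by rewrite /v; lra.
  have v3 : 0 <= v ^+ 3 by rewrite exprn_ge0.
  have v2 : 0 <= v ^+ 2 by rewrite exprn_ge0.
  have v32 : v ^+ 3 <= v ^+ 2 by rewrite exprSr ler_piMr.
  have v21 : v ^+ 2 <= v by rewrite expr2 ler_piMr.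
  by rewrite addrK; apply/andP; split; nra.
(* On [2, 3] the step is 1 - w^3 / 6, the mirror image of x^3 / 6 on [0, 1]. *)
pose w := 3 - x; have -> : x = 3 - w by rewrite /w; lra.
have w0 : 0 <= w by rewrite /w; lra.
have w3 : 0 <= w ^+ 3 by rewrite exprn_ge0.
have : w ^+ 3 <= 1 by rewrite exprn_ile1// /w; lra.
by move=> ?; apply/andP; split; nra.
Qed.

Lemma smooth_step : exists K, smooth K step.
Proof.
have s0 := smooth_cube_pos.
have s1 := smoothZ (- 3) (smooth_affine 1 (- 1) s0).
have s2 := smoothZ 3 (smooth_affine 1 (- 2) s0).
have s3 := smoothZ (- 1) (smooth_affine 1 (- 3) s0).
have := smoothZ 6^-1 (smoothD (smoothD (smoothD s0 s1) s2) s3).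
set K := (X in smooth X _) => H; exists K; move: H; congr smooth.
by apply/funext => x; rewrite /step !mul1r; ring.
Qed.

Lemma measurable_step : measurable_fun [set: R] step.
Proof.
have mc (r : R) : measurable_fun [set: R] (fun x => cube_pos (x - r)).
  apply: measurable_funX; apply: measurable_maxr => //.
  exact: measurable_funB.
apply: measurable_funM => //; apply: measurable_funB => //.
apply: measurable_funD; last exact: measurable_funM.
apply: measurable_funB; last exact: measurable_funM.
by apply: measurable_funX; exact: measurable_maxr.
Qed.

(** For positive [k] the rise takes place on [a, a + 3 / k], so slope parameter [3 / del] gives a
    rise of width [del]. *)
Definition step_at (a k x : R) : R := step (k * x - k * a).

Lemma bmf_step_at a k : bmf (step_at a k).
Proof.
split.
  apply: measurableT_comp; first exact: measurable_step.
  by apply: measurable_funB => //; exact: measurable_funM.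
exists 1 => x; have /andP[s0 s1] := step_itv (k * x - k * a).
by rewrite ger0_norm.
Qed.

Lemma smooth_step_at a k : exists K, smooth K (step_at a k).
Proof.
have [K sK] := smooth_step; exists (K * `|k| ^+ 3).
exact: smooth_affine sK.
Qed.

End taylor.

(** * The mean of a test function, expanded to second order *)

Section third_moment.
Context {R : realType} {d : measure_display} {T : measurableType d}.
Variables (Q : probability T R) (Y : T -> R).
Hypotheses (mY : measurable_fun [set: T] Y)
  (iY3 : Q.-integrable [set: T] (EFin \o (fun w => `|Y w| ^+ 3))).

Lemma integrable_le_third_moment (f : T -> R) : measurable_fun [set: T] f ->
  (forall w, `|f w| <= 1 + `|Y w| ^+ 3) -> Q.-integrable [set: T] (EFin \o f).
Proof.
move=> mf fY.
have i1 : Q.-integrable [set: T] (EFin \o (fun w => 1 + `|Y w| ^+ 3)).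
  rewrite (_ : _ \o _ = ((EFin \o cst 1%R) \+ (EFin \o (fun w => (`|Y w| ^+ 3)%R)))%E)//.
  by apply: integrableD => //; apply: bmf_integrable; exact: bmf_cst.
apply: le_integrable i1 => //; first exact/measurable_EFinP.
by move=> w _; rewrite /= lee_fin [leRHS]ger0_norm// addr_ge0// exprn_ge0.
Qed.

(** The linear term has mean zero and the quadratic one sees only the second moment. Two centered
    laws with equal second moments therefore differ, up to the cubic remainder, not at all. A third
    moment is assumed instead of boundedness so that the Gaussian is covered too. *)
Lemma taylor2_mean (t K : R) (u u1 u2 : R -> R) x : 0 <= t ->
  bmf u -> taylor2 K u u1 u2 -> \int[Q]_w Y w = 0 ->
  `|mean Q (fun w => u (x + t * Y w)) - u x - t ^+ 2 * (\int[Q]_w Y w ^+ 2) * u2 x|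
    <= K * t ^+ 3 * \int[Q]_w `|Y w| ^+ 3.
Proof.
move=> t0 bu tu Y0.
have mn : measurable_fun [set: T] (fun w => `|Y w|) by exact: measurableT_comp.
(* One inequality that makes the first and second moments finite from the third. *)
have cubeP (z : R) : 0 <= z -> z + z ^+ 2 <= 1 + z ^+ 3.
  move=> z0; rewrite -subr_ge0 (_ : _ - _ = (z - 1) ^+ 2 * (z + 1)); last by ring.
  by rewrite mulr_ge0 ?sqr_ge0// addr_ge0.
have iY : Q.-integrable [set: T] (EFin \o Y).
  apply: integrable_le_third_moment => // w.
  by have := cubeP `|Y w|; rewrite normr_ge0 => /(_ isT); have := sqr_ge0 `|Y w|; lra.
have mY2 : measurable_fun [set: T] (fun w => Y w ^+ 2) by exact: measurable_funX.
have iY2 : Q.-integrable [set: T] (EFin \o (fun w => Y w ^+ 2)).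
  apply: integrable_le_third_moment => // w; rewrite normrX.
  by have := cubeP `|Y w|; rewrite normr_ge0 => /(_ isT); have := normr_ge0 (Y w); lra.
have buY : bmf (fun w => u (x + t * Y w)).
  apply: bmf_comp => //; apply: measurable_funD => //; exact: measurable_funM.
have iu : Q.-integrable [set: T] (EFin \o (fun w => u (x + t * Y w))).
  exact: bmf_integrable.
have ic (r : R) : Q.-integrable [set: T] (EFin \o (fun=> r)).
  by apply: bmf_integrable; exact: bmf_cst.
have i1 (r : R) : Q.-integrable [set: T] (EFin \o (fun w => r * Y w)).
  rewrite (_ : _ \o _ = fun w => (r%:E * (Y w)%:E)%E)//.
  exact: integrableZl.
have i2 (r : R) : Q.-integrable [set: T] (EFin \o (fun w => r * Y w ^+ 2)).
  rewrite (_ : _ \o _ = fun w => (r%:E * (Y w ^+ 2)%R%:E)%E)//.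
  exact: (@integrableZl _ _ _ _ _ _ _ (EFin \o (fun w => Y w ^+ 2))).
have i3 (r : R) : Q.-integrable [set: T] (EFin \o (fun w => r * `|Y w| ^+ 3)).
  rewrite (_ : _ \o _ = fun w => (r%:E * (`|Y w| ^+ 3)%R%:E)%E)//.
  exact: (@integrableZl _ _ _ _ _ _ _ (EFin \o (fun w => `|Y w| ^+ 3))).
have iB f g : Q.-integrable [set: T] (EFin \o f) ->
    Q.-integrable [set: T] (EFin \o g) ->
    Q.-integrable [set: T] (EFin \o (fun w => f w - g w)).
  move=> jf jg; rewrite (_ : _ \o _ = ((EFin \o f) \- (EFin \o g))%E)//.
  exact: integrableB.
rewrite -[leRHS]RintegralZl//.
have -> : mean Q (fun w => u (x + t * Y w)) - u x
    - t ^+ 2 * (\int[Q]_w Y w ^+ 2) * u2 x =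
  \int[Q]_w (u (x + t * Y w) - u x - (t * u1 x) * Y w - (t ^+ 2 * u2 x) * Y w ^+ 2).
  rewrite RintegralB//; last by apply: (iB) => //; exact: iB.
  rewrite RintegralB//; last exact: iB.
  rewrite RintegralB// /mean !RintegralZl// Y0.
  have -> : \int[Q]_w u x = u x := mean_cst Q (u x).
  by ring.
apply: le_trans (le_normr_Rintegral _ _) _ => //.
  by apply: (iB) => //; apply: (iB) => //; exact: iB.
apply: le_Rintegral => //.
  rewrite (_ : _ \o _ = abse \o (EFin \o (fun w => u (x + t * Y w) - u x -
     t * u1 x * Y w - t ^+ 2 * u2 x * Y w ^+ 2)))//.
  by apply: integrable_abse; apply: (iB) => //; apply: (iB) => //; exact: iB.
move=> w _; rewrite [leRHS](_ : _ = K * `|t * Y w| ^+ 3); last first.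
  by rewrite normrM (ger0_norm t0); ring.
apply: le_trans (tu x (t * Y w)); rewrite le_eqVlt; apply/orP; left; apply/eqP.
by congr `|_|; ring.
Qed.

End third_moment.

(** * Gaussian smoothing of test functions as a semigroup *)

Section gaussian_smoothing.
Context {R : realType}.
Implicit Types (g u : R -> R) (K a b s : R).

Definition stdnormal : probability (measurableTypeR R) R := normal_prob 0 1.

Lemma ge0_integral_lebesgueN (F : R -> \bar R) : measurable_fun [set: R] F ->
  (forall x, 0 <= F x)%E ->
  (\int[@lebesgue_measure R]_x F (- x)%R = \int[@lebesgue_measure R]_x F x)%E.
Proof.
move=> mF F0.
have mN : measurable_fun [set: measurableTypeR R]
  (-%R : measurableTypeR R -> measurableTypeR R) by exact: oppr_measurable.
have := @ge0_integral_pushforward _ _ _ _ _ _ mN (@lebesgue_measure R) setT F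
  measurableT mF (fun y _ => F0 y).
rewrite preimage_setT => <-.
by apply: eq_measure_integral => A mA _; exact: lebesgue_measureN.
Qed.

Lemma integral_stdnormalN (f : R -> \bar R) : measurable_fun [set: R] f ->
  (forall x, 0 <= f x)%E ->
  (\int[stdnormal]_x f (- x)%R = \int[stdnormal]_x f x)%E.
Proof.
move=> mf f0; rewrite !ge0_integral_normal_prob//; last first.
  by apply: measurableT_comp => //; exact: oppr_measurable.
pose F (x : R) : \bar R := (f x * (normal_pdf 0 1 x)%:E)%E.
have mF : measurable_fun [set: R] F.
  apply: emeasurable_funM => //; apply/measurable_EFinP.
  exact: measurable_normal_pdf.
have F0 x : (0 <= F x)%E by rewrite mule_ge0// lee_fin normal_pdf_ge0.
rewrite -(ge0_integral_lebesgueN mF F0); apply: eq_integral => x _; rewrite /F.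
congr (_ * _%:E)%E; rewrite !normal_pdf_gt0E// /normal_fun; congr (_ * expR _).
by rewrite !subr0 sqrrN.
Qed.

Lemma mean_stdnormal : \int[stdnormal]_x x = 0.
Proof.
have mE : measurable_fun [set: R] (EFin : R -> \bar R) by exact: EFin_measurable.
rewrite /Rintegral integralE -(integral_stdnormalN (measurable_funepos mE))//.
rewrite (_ : (fun x : R => (EFin^\+ (- x)%R)%E) = (EFin^\-)%E); last first.
  by apply/funext => x; rewrite funeposE funenegE.
(* By symmetry the positive and negative parts have the same integral; whether it is finite or not,
   [fine] of the difference is 0. *)
by case: (integral _ _ _) => [r| |]//=; rewrite subrr.
Qed.

(* Its value 1 plays no role: the limit law may have any standard deviation. *)
Definition normal_variance : R := \int[stdnormal]_x (x ^+ 2).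

(** Otherwise x^2 would vanish almost everywhere, and all the mass would sit at 0, a Lebesgue null
    set. *)
Lemma normal_variance_gt0 : 0 < normal_variance.
Proof.
have m2 : measurable_fun [set: R] (fun x : R => (x ^+ 2)%:E).
  by apply/measurable_EFinP; exact: measurable_funX.
have i2 : stdnormal.-integrable [set: R] (EFin \o (fun x => x ^+ 2)).
  apply: (@integrable_le_third_moment _ _ _ stdnormal idfun) => //.
    exact: integrable_normal_prob_cube.
  move=> x; rewrite normrX/=; have := normr_ge0 x; set z := `|x| => z0.
  rewrite -subr_ge0 (_ : _ - _ = (z - 1) ^+ 2 * (z + 1) + z); last by ring.
  by rewrite addr_ge0// mulr_ge0 ?sqr_ge0// addr_ge0.
rewrite lt_neqAle Rintegral_ge0 ?andbT; last by move=> x _; exact: sqr_ge0.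
apply/eqP => v0.
have : (\int[stdnormal]_x `|(x ^+ 2)%:E| = 0)%E.
  under eq_integral do rewrite gee0_abs ?lee_fin ?sqr_ge0//.
  by rewrite -[RHS]/(0%R%:E) v0 /normal_variance /Rintegral fineK//; exact: integrable_fin_num i2.
move=> /(ae_eq_integral_abs stdnormal measurableT m2) [N [mN N0 xN]].
have l0 : stdnormal [set (0 : R)] = 0%E.
  have /null_content_dominatesP := normal_prob_dominates (0 : R) 1.
  by apply => //; exact: lebesgue_measure_set1.
pose A : set R := N `|` [set 0].
have : (stdnormal [set: R] <= stdnormal A)%E.
  apply: le_measure; rewrite ?inE//; first exact: measurableU.
  move=> x _; have [->|x0] := eqVneq x 0; [by right|left].
  apply: xN => /= /(_ I) [] /eqP; rewrite sqrf_eq0; exact/negP.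
rewrite probability_setT => /le_trans /(_ (measureU2 _ mN (measurable_set1 _))).
by rewrite /= [X in (_ <= X + _)%E]N0 [X in (_ <= _ + X)%E]l0 adde0 lee_fin ler10.
Qed.

(** Scaling a standard normal, rather than integrating against [normal_prob 0 s], makes s = 0 the
    identity, whereas the library reads deviation 0 as a uniform law. *)
Definition gauss s u (x : R) : R := mean stdnormal (fun z => u (x + s * z)).

Lemma bmf_gauss s u : bmf u -> bmf (gauss s u).
Proof.
move=> bu.
suff h : bmf (fun z : measurableTypeR R * measurableTypeR R => u (z.1 + s * z.2)).
  exact: bmf_mean h stdnormal.
apply: bmf_comp => //; apply: measurable_funD; first exact: measurable_fst.
by apply: measurable_funM => //; exact: measurable_snd.
Qed.

Lemma gauss_ge0 s u x : (forall x, 0 <= u x) -> 0 <= gauss s u x.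
Proof. by move=> u0; exact: mean_ge0. Qed.

Lemma smooth_gauss s K u : bmf u -> smooth K u -> smooth K (gauss s u).
Proof.
move=> bu [u1 [u2 [mu1 mu2 tu]]].
have [_ [M uM]] := bu; have [b1 b2] := taylor2_bounded uM tu.
have bu1 : bmf u1 by split => //; exists (2 * M + K).
have bu2 : bmf u2 by split => //; exists (2 * M + K).
have bs (g : R -> R) x : bmf g -> bmf (fun z : measurableTypeR R => g (x + s * z)).
  by move=> bg; apply: bmf_comp => //; exact: measurable_funD.
exists (gauss s u1), (gauss s u2); split; [exact: (bmf_gauss _ _).1|exact: (bmf_gauss _ _).1|].
move=> x y; rewrite /gauss -!meanZ; [|exact: bs..].
have bz r (g : R -> R) : bmf g -> bmf (fun z : measurableTypeR R => r * g (x + s * z)).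
  by move=> bg; apply: bmfM; [exact: bmf_cst|exact: bs].
rewrite -!meanB; try by do ?apply: bmfB; first [exact: bs|exact: bz].
apply: mean_le; first by do ?apply: bmfB; first [exact: bs|exact: bz].
by move=> z; rewrite (addrAC x y); exact: tu.
Qed.

Lemma gaussE s (u : R -> R) x : 0 < s -> bmf u -> continuous u ->
  (forall x, 0 <= u x) ->
  (gauss s u x)%:E = (\int[normal_prob 0 s]_z (u (x + z))%:E)%E.
Proof.
move=> s0 bu cu u0; rewrite /gauss meanE; last first.
  by apply: bmf_comp => //; exact: measurable_funD.
rewrite normal_prob_scale// => z.
apply: (cvg_comp (fun z => x + z) u); last exact: cu.
by apply: (@cvgD _ R^o) => //; exact: cvg_cst.
Qed.

(** Variances add, by [normal_prob_convolution]. A zero deviation is treated apart because the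
    convolution lemma is about genuine densities. *)
Lemma gauss_gauss a b K u x : 0 <= a -> 0 <= b -> bmf u -> smooth K u ->
  (forall x, 0 <= u x) ->
  gauss a (gauss b u) x = gauss (Num.sqrt (a ^+ 2 + b ^+ 2)) u x.
Proof.
move=> a0 b0 bu su u0; have cu := smooth_continuous bu su.
have g0 (v : R -> R) y : gauss 0 v y = v y.
  by rewrite /gauss; under eq_mean do rewrite mul0r addr0; rewrite mean_cst.
have [->|aN0] := eqVneq a 0.
  by rewrite expr0n add0r sqrtr_sqr ger0_norm// g0.
have [->|bN0] := eqVneq b 0.
  rewrite expr0n addr0 sqrtr_sqr ger0_norm//.
  by apply: eq_mean => z; rewrite g0.
have {a0 aN0}a0 : 0 < a by rewrite lt_neqAle eq_sym aN0.
have {b0 bN0}b0 : 0 < b by rewrite lt_neqAle eq_sym bN0.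
set c := Num.sqrt _.
have c0 : 0 < c by rewrite sqrtr_gt0 addr_gt0// exprn_gt0.
have cE : c ^+ 2 = a ^+ 2 + b ^+ 2 by rewrite sqr_sqrtr// addr_ge0// sqr_ge0.
have cv y (v : R -> R) : continuous v -> continuous (fun z : R => v (y + z)).
  move=> cv z; apply: (cvg_comp (fun z => y + z) v); last exact: cv.
  by apply: (@cvgD _ R^o) => //; exact: cvg_cst.
have cg := smooth_continuous (bmf_gauss b bu) (smooth_gauss b bu su).
have pg y : 0 <= gauss b u y by exact: gauss_ge0.
apply: EFin_inj; rewrite (gaussE _ a0 (bmf_gauss b bu) cg pg) (gaussE _ c0 bu cu u0).
rewrite -(normal_prob_convolution a0 b0 c0 cE (cv x _ cu) (fun y => u0 (x + y))).
apply: eq_integral => y _; rewrite (gaussE _ b0 bu cu u0).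
by apply: eq_integral => z _; rewrite addrA.
Qed.

Lemma mean_centered_gaussian s K u : 0 <= s -> bmf u -> smooth K u -> (forall x, 0 <= u x) ->
  mean (centered_gaussian s) u = gauss s u 0.
Proof.
move=> s_ge0 bu su u0; have cu := smooth_continuous bu su.
rewrite /centered_gaussian; case: ifPn => [/eqP->|sN0].
  rewrite /gauss; under [RHS]eq_mean do rewrite mul0r addr0.
  rewrite mean_cst; apply: EFin_inj; rewrite meanE// integral_dirac//.
    by rewrite diracT mul1e.
  by apply/measurable_EFinP; have [] := bu.
have s0 : 0 < s by rewrite lt_neqAle eq_sym sN0.
apply: EFin_inj.
apply: (etrans (meanE (normal_prob 0 s) bu)); apply/esym.
apply: (etrans (gaussE 0 s0 bu cu u0)).
by apply: eq_integral => x _; rewrite add0r.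
Qed.

End gaussian_smoothing.

(** * Lindeberg's exchange argument for bounded summands, with a rate *)

Section lindeberg.
Context {R : realType} {d : measure_display} {T : measurableType d}.
Variables (P : probability T R) (Y : nat -> T -> R) (b v : R).
Hypotheses (mY : forall n, measurable_fun [set: T] (Y n))
  (Yb : forall n w, `|Y n w| <= b)
  (Y0 : forall n, mean P (Y n) = 0)
  (Yv : forall n, mean P (fun w => Y n w ^+ 2) = v).
Hypothesis indepY : forall n (t : R) (u : R -> R), bmf u ->
  mean P (fun w => u (t * (\sum_(j < n) Y j w) + t * Y n w)) =
  mean P (fun w => mean P (fun w' => u (t * (\sum_(j < n) Y j w) + t * Y n w'))).

(** The scale at which a standard normal acquires the second moment [v] of the summands. *)
Let s := Num.sqrt (v / @normal_variance R).
Let m3 : R := \int[@stdnormal R]_x `|x| ^+ 3.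

Let v_ge0 : 0 <= v.
Proof. by rewrite -(Yv 0); apply: mean_ge0 => w; exact: sqr_ge0. Qed.

Let sE : s ^+ 2 * @normal_variance R = v.
Proof.
have c0 := @normal_variance_gt0 R.
by rewrite sqr_sqrtr ?divr_ge0 ?(ltW c0)// divfK// gt_eqF.
Qed.

Lemma bmf_partial_sum n : bmf (fun w => \sum_(j < n) Y j w).
Proof. by apply: bmf_sum => i; split => //; exists b. Qed.

(** By [indepY] the partial sum can be frozen at x. The last summand and the Gaussian replacing it
    are both expanded around x by [taylor2_mean]; the quadratic terms cancel because the second
    moments agree, and the two cubic remainders are left. *)
Let lindeberg_step K u t n : 0 <= t -> bmf u -> smooth K u ->
  `|mean P (fun w => u (t * \sum_(j < n.+1) Y j w)) -
    mean P (fun w => gauss (t * s) u (t * \sum_(j < n) Y j w))|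
  <= K * t ^+ 3 * (b ^+ 3 + s ^+ 3 * m3).
Proof.
move=> t0 bu [u1 [u2 [mu1 mu2 tu]]]; have K0 := taylor2_ge0 tu.
have s0 : 0 <= s by exact: sqrtr_ge0.
have bS := bmf_partial_sum n.
have bY : bmf (Y n) by split => //; exists b.
have btS : measurable_fun [set: T] (fun w => t * \sum_(j < n) Y j w).
  by apply: measurable_funM => //; exact: bS.1.
have -> : mean P (fun w => u (t * \sum_(j < n.+1) Y j w)) =
    mean P (fun w => u (t * (\sum_(j < n) Y j w) + t * Y n w)).
  by apply: eq_mean => w; rewrite big_ord_recr mulrDr.
rewrite indepY//.
have bA : bmf (fun w => mean P (fun w' => u (t * (\sum_(j < n) Y j w) + t * Y n w'))).
  have h : bmf (fun z : R * T => u (z.1 + t * Y n z.2)).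
    apply: bmf_comp => //; apply: measurable_funD => //.
    by apply: measurable_funM => //; exact: measurableT_comp.
  exact: bmf_comp (bmf_mean h P) btS.
have bB : bmf (fun w => gauss (t * s) u (t * \sum_(j < n) Y j w)).
  by apply: bmf_comp btS; exact: bmf_gauss.
rewrite -meanB//; apply: mean_le; first exact: bmfB.
move=> w; set x := t * \sum_(j < n) Y j w.
have bY3 : bmf (fun w => `|Y n w| ^+ 3) by apply: bmfX; exact: bmf_norm.
have ts0 : 0 <= t * s by rewrite mulr_ge0.
have hA := @taylor2_mean _ _ _ P (Y n) (mY n) (bmf_integrable P bY3) t K u u1 u2 x t0
  bu tu (Y0 n).
have hB := @taylor2_mean _ _ _ (@stdnormal R) idfun (@measurable_id _ _ _)
  (@integrable_normal_prob_cube R) (t * s) K u u1 u2 x ts0 bu tu (@mean_stdnormal R).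
have hv : (t * s) ^+ 2 * (\int[@stdnormal R]_z z ^+ 2) = t ^+ 2 * v.
  by rewrite exprMn -mulrA sE.
have hY : \int[P]_w Y n w ^+ 2 = v by exact: Yv.
have hb : \int[P]_w `|Y n w| ^+ 3 <= b ^+ 3.
  rewrite -[leRHS](mean_cst P); apply: le_mean => //; first exact: bmf_cst.
  by move=> z; rewrite lerXn2r ?nnegrE// (le_trans _ (Yb n z)).
rewrite hY in hA; rewrite hv in hB.
move: hA hB; set A := mean P _; rewrite -/(gauss (t * s) u x); set B := gauss _ _ _.
move=> hA hB; rewrite (_ : _ - _ = (A - u x - t ^+ 2 * v * u2 x) -
   (B - u x - t ^+ 2 * v * u2 x)); last first.
  by ring.
rewrite (le_trans (ler_normB _ _))// mulrDr lerD//.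
  by rewrite (le_trans hA)// ler_wpM2l// mulr_ge0// exprn_ge0.
by rewrite (le_trans hB)// exprMn !mulrA.
Qed.

(* The last summand is exchanged for a Gaussian one; this only replaces the test
   function by its Gaussian smoothing, which satisfies the same Taylor bound. *)
Lemma lindeberg K u t n : 0 <= t -> bmf u -> smooth K u -> (forall x, 0 <= u x) ->
  `|mean P (fun w => u (t * \sum_(j < n) Y j w)) - gauss (t * s * Num.sqrt n%:R) u 0|
  <= n%:R * (K * t ^+ 3 * (b ^+ 3 + s ^+ 3 * m3)).
Proof.
move=> t0; elim: n u => [|n IH] u bu su u0.
  rewrite mul0r sqrtr0 mulr0 /gauss.
  under eq_mean do rewrite big_ord0 mulr0.
  under [X in _ - X]eq_mean do rewrite mul0r addr0.
  by rewrite !mean_cst subrr normr0.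
have s0 : 0 <= s by exact: sqrtr_ge0.
have ts0 : 0 <= t * s by rewrite mulr_ge0.
(* The induction hypothesis is used for the smoothed test function; the n Gaussians it produces and
   the smoothing already present merge into deviation t s sqrt(n + 1). *)
have := IH _ (bmf_gauss (t * s) bu) (smooth_gauss (t * s) bu su)
  (fun x => gauss_ge0 (t * s) x u0).
rewrite (gauss_gauss _ _ ts0 bu su u0) ?mulr_ge0// => IHn.
rewrite (_ : Num.sqrt (_ + _) = t * s * Num.sqrt n.+1%:R) in IHn; last first.
  rewrite exprMn sqr_sqrtr// -[X in _ + X]mulr1 -mulrDr -natr1 sqrtrM ?sqr_ge0//.
  by rewrite sqrtr_sqr ger0_norm.
rewrite -[in leRHS]natr1 mulrDl mul1r.
rewrite (_ : mean _ _ - _ = (mean P (fun w => u (t * \sum_(j < n.+1) Y j w)) -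
    mean P (fun w => gauss (t * s) u (t * \sum_(j < n) Y j w))) +
  (mean P (fun w => gauss (t * s) u (t * \sum_(j < n) Y j w)) -
   gauss (t * s * Num.sqrt n.+1%:R) u 0)); last by ring.
rewrite (le_trans (ler_normD _ _))// addrC lerD//.
exact: lindeberg_step.
Qed.

(** At scale t = 1 / sqrt n, the n exchanges cost t^3 each, hence 1 / sqrt n in total. The constant
    is chosen before the test function. *)
Lemma clt : exists C, forall K u n, bmf u -> smooth K u -> (forall x, 0 <= u x) ->
  (0 < n)%N ->
  `|mean P (fun w => u ((Num.sqrt n%:R)^-1 * \sum_(j < n) Y j w)) -
    mean (centered_gaussian s) u| <= K * C / Num.sqrt n%:R.
Proof.
exists (b ^+ 3 + s ^+ 3 * m3) => K u n bu su u0 n0.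
have r0 : 0 < Num.sqrt n%:R :> R by rewrite sqrtr_gt0 ltr0n.
have := @lindeberg K u (Num.sqrt n%:R)^-1 n _ bu su u0.
rewrite invr_ge0 (ltW r0) => /(_ isT).
rewrite mulrAC mulVf ?gt_eqF// mul1r (mean_centered_gaussian (sqrtr_ge0 _) bu su u0).
move=> /le_trans; apply; rewrite le_eqVlt; apply/orP; left; apply/eqP.
rewrite -{1}(@sqr_sqrtr _ n%:R)//; field; exact: lt0r_neq0.
Qed.

End lindeberg.

(** * Smooth steps determine weak convergence *)

Section weak_convergence.
Context {R : realType}.
Implicit Types (g : R -> R).

(** Uniform continuity on [-A, A] by sequential compactness: pairs violating it at gap 1 / (n + 1)
    would accumulate at a point where [g] is not continuous. The modulus is the inverse of an
    integer so that nodes can later divide [-A, A] evenly. *)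
Lemma continuous_itv_mesh g (A eta : R) : continuous g -> 0 < eta ->
  exists2 m : nat, (0 < m)%N & forall x y, `|x| <= A -> `|y| <= A ->
    `|x - y| <= m%:R^-1 -> `|g x - g y| <= eta.
Proof.
move=> cg e0; apply: contrapT => H.
have xy (n : nat) : exists p : R * R, [/\ `|p.1| <= A, `|p.2| <= A,
    `|p.1 - p.2| <= n.+1%:R^-1 & eta < `|g p.1 - g p.2|].
  apply: contrapT => Hn; apply: H; exists n.+1 => // x y xA yA xy.
  by rewrite leNgt; apply/negP => gxy; apply: Hn; exists (x, y).
pose p n := sval (cid (xy n)).
have pP n : [/\ `|(p n).1| <= A, `|(p n).2| <= A,
    `|(p n).1 - (p n).2| <= n.+1%:R^-1 & eta < `|g (p n).1 - g (p n).2|].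
  by rewrite /p; case: cid.
have [|f finc fcvg] := @bolzano_weierstrass R (fun n => (p n).1).
  exists A; split; first exact: num_real.
  by move=> B AB n _; have [+ _ _ _] := pP n; move=> /le_trans; apply; exact: ltW.
move: fcvg => /cvg_ex[/= l fl].
have nf n : (n <= f n)%N.
  elim: n => // n IH; apply: leq_ltn_trans IH _.
  by have := finc n.+1 n; rewrite !leEnat ltnn ltnNge => ->.
have e20 : 0 < eta / 2 by rewrite divr_gt0.
have /(@cvgrPdist_lt _ R^o) /(_ _ e20) [del /= del0 gl] := cg l.
have d20 : 0 < del / 2 by rewrite divr_gt0.
have /(@cvgrPdist_lt _ R^o) /(_ _ d20) [N1 _ N1P] := fl.
have [N2 N2P] : exists N, forall n, (N <= n)%N -> n.+1%:R^-1 < del / 2.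
  have := @near_infty_natSinv_lt R (PosNum d20).
  by move=> [N _ NP]; exists N => n Nn; exact: NP.
pose n := maxn N1 N2; have /= h1 := N1P n (leq_maxl _ _).
have h2 := N2P (f n) (leq_trans (leq_maxr _ _) (nf n)).
have [_ _ h3 h4] := pP (f n).
have g1 : `|g l - g (p (f n)).1| < eta / 2.
  by apply: gl => /=; rewrite (lt_trans h1)// ltr_pdivrMr// ltr_pMr// ltr1n.
have g2 : `|g l - g (p (f n)).2| < eta / 2.
  apply: gl => /=; rewrite -(subrKA (p (f n)).1) (le_lt_trans (ler_normD _ _))//.
  by rewrite [ltRHS](splitr del) ltrD// (le_lt_trans h3).
move: h4; rewrite ltNge => /negP; apply.
rewrite -(subrKA (g l)) (le_trans (ler_normD _ _))// distrC ltW//.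
by rewrite [ltRHS](splitr eta) ltrD.
Qed.

Lemma step_at_itv (a k x : R) : 0 <= step_at a k x <= 1.
Proof. exact: step_itv. Qed.

Lemma step_at_left (a del x : R) : 0 < del -> x <= a -> step_at a (3 / del) x = 0.
Proof.
move=> d0 xa; rewrite /step_at step_le0// subr_le0 ler_pM2l//.
by rewrite divr_gt0.
Qed.

Lemma step_at_right (a del x : R) : 0 < del -> a + del <= x ->
  step_at a (3 / del) x = 1.
Proof.
move=> d0 xa; rewrite /step_at step_ge3// -mulrBr mulrAC ler_pdivlMr//.
by rewrite ler_pM2l// lerBrDl.
Qed.

(** A telescoping interpolation of [g] at the nodes x0 + i del: the i-th step rises only between the
    nodes i and i + 1. *)
Definition step_interpolation g (x0 del : R) (m : nat) (x : R) :=
  g x0 + \sum_(i < m) (g (x0 + i.+1%:R * del) - g (x0 + i%:R * del)) *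
    step_at (x0 + i%:R * del) (3 / del) x.

Section interpolation.
Variables (g : R -> R) (x0 del eta : R).
Hypothesis (d0 : 0 < del).
Local Notation G := (step_interpolation g x0 del).

Lemma step_interpolationS m x : G m.+1 x = G m x +
  (g (x0 + m.+1%:R * del) - g (x0 + m%:R * del)) *
    step_at (x0 + m%:R * del) (3 / del) x.
Proof. by rewrite /step_interpolation big_ord_recr/= addrA. Qed.

Lemma step_interpolation_left m x : x <= x0 -> G m x = g x0.
Proof.
move=> xx0; rewrite /step_interpolation big1 ?addr0// => i _.
rewrite step_at_left ?mulr0// (le_trans xx0)// lerDl.
by rewrite mulr_ge0// ltW.
Qed.

Lemma step_interpolation_right m x : x0 + m%:R * del <= x ->
  G m x = g (x0 + m%:R * del).
Proof.
elim: m => [|m IH] xm; first by rewrite /step_interpolation big_ord0 mul0r !addr0.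
have xm' : x0 + m%:R * del + del <= x.
  by apply: le_trans xm; rewrite -natr1 mulrDl mul1r addrA.
rewrite step_interpolationS IH ?step_at_right//.
  by rewrite mulr1 addrCA subrr addr0.
by apply: le_trans xm'; rewrite lerDl ltW.
Qed.

(** Between two neighbouring nodes earlier steps are 1 and later ones 0, so the interpolation is a
    convex combination of two values of [g] that are close to [g x]. *)
Lemma step_interpolation_close m x :
  (forall y z, x0 <= y <= x0 + m%:R * del -> x0 <= z <= x0 + m%:R * del ->
    `|y - z| <= del -> `|g y - g z| <= eta) ->
  x0 <= x <= x0 + m%:R * del -> `|G m x - g x| <= 2 * eta.
Proof.
elim: m => [|m IH] close /andP[x0x xm].
  have xE : x = x0 by apply/eqP; rewrite eq_le x0x andbT (le_trans xm)// mul0r addr0.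
  rewrite xE /step_interpolation big_ord0 addr0 subrr normr0 mulr_ge0//.
  by have := close x0 x0; rewrite !subrr normr0 mul0r addr0 lexx ltW//; exact.
have mm : x0 + m%:R * del <= x0 + m.+1%:R * del.
  by rewrite lerD2l ler_wpM2r ?(ltW d0)// ler_nat.
rewrite step_interpolationS.
have [xm'|xm'] := leP x (x0 + m%:R * del).
  rewrite step_at_left// mulr0 addr0; apply: IH; last by rewrite x0x.
  by move=> y z /andP[y0 ym] /andP[z0 zm]; apply: close;
    rewrite ?y0 ?z0 (le_trans _ mm).
rewrite step_interpolation_right ?(ltW xm')//.
set y := x0 + m%:R * del in mm xm' *; set z := x0 + m.+1%:R * del in xm mm *.
have zy : z = y + del by rewrite /z /y -natr1 mulrDl mul1r addrA.
have y0 : x0 <= y by rewrite /y lerDl mulr_ge0// ltW.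
have /andP[s0 s1] := step_at_itv y (3 / del) x.
have n1 : `|g y - g x| <= eta.
  apply: close; [by rewrite y0 mm|by rewrite x0x xm|].
  by rewrite ler0_norm ?subr_le0 ?(ltW xm')// opprB lerBlDl -zy.
have n2 : `|g z - g y| <= eta.
  apply: close; [by rewrite (le_trans y0) ?mm /=|by rewrite y0 mm|].
  by rewrite zy addrAC subrr add0r ger0_norm// ltW.
rewrite (_ : _ - _ = (g y - g x) + (g z - g y) * step_at y (3 / del) x); last by ring.
rewrite (le_trans (ler_normD _ _))// (_ : 2 * eta = eta + eta); last by ring.
rewrite lerD// normrM (ger0_norm s0).
by rewrite (le_trans _ n2)// ler_piMr.
Qed.

End interpolation.

Section criterion.
Context {d : measure_display} {T : measurableType d}.
Variables (P : probability T R) (Y : nat -> T -> R).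
Variable mu : probability (measurableTypeR R) R.
Hypothesis mY : forall n, measurable_fun [set: T] (Y n).
Hypothesis stepY : forall a k : R,
  mean P (fun w => step_at a k (Y n w)) @[n --> \oo] --> mean mu (step_at a k).

Let converges (h : R -> R) := bmf h /\
  (mean P (fun w => h (Y n w)) @[n --> \oo] --> mean mu h).

Let converges_cst r : converges (fun=> r).
Proof.
split; first exact: bmf_cst.
by rewrite !mean_cst; exact: cvg_cst.
Qed.

Let convergesD h k : converges h -> converges k -> converges (fun x => h x + k x).
Proof.
move=> [bh ch] [bk ck]; split; first exact: bmfD.
have bY u n : bmf u -> bmf (fun w => u (Y n w)) by move=> bu; exact: bmf_comp.
rewrite meanD// [X in X @ _](_ : _ = (fun n =>
    mean P (fun w => h (Y n w)) + mean P (fun w => k (Y n w)))); last first.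
  by apply/funext => n; rewrite meanD//; exact: bY.
exact: (@cvgD _ R^o).
Qed.

Let convergesZ r h : converges h -> converges (fun x => r * h x).
Proof.
move=> [bh ch]; split; first by apply: bmfM => //; exact: bmf_cst.
have bY u n : bmf u -> bmf (fun w => u (Y n w)) by move=> bu; exact: bmf_comp.
rewrite meanZ// [X in X @ _](_ : _ =
    (fun n => r * mean P (fun w => h (Y n w)))); last first.
  by apply/funext => n; rewrite meanZ//; exact: bY.
by apply: cvgM => //; exact: cvg_cst.
Qed.

Let converges_step a k : converges (step_at a k).
Proof. by split; [exact: bmf_step_at|exact: stepY]. Qed.

Let converges_interpolation g x0 del m : converges (step_interpolation g x0 del m).
Proof.
elim: m => [|m IH].
  rewrite (_ : step_interpolation _ _ _ _ = fun=> g x0)//.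
  by apply/funext => x; rewrite /step_interpolation big_ord0 addr0.
rewrite (_ : step_interpolation _ _ _ _ = fun x => step_interpolation g x0 del m x +
  (g (x0 + m.+1%:R * del) - g (x0 + m%:R * del)) *
    step_at (x0 + m%:R * del) (3 / del) x); last first.
  by apply/funext => x; rewrite step_interpolationS.
by apply: convergesD => //; exact: convergesZ.
Qed.

(** A majorant of the indicator of |x| > A that vanishes for |x| <= A - 1. Being made of steps, its
    means converge as well, so tightness comes out of the hypothesis on steps. *)
Let tail (A : nat) (x : R) := 1 + (step_at (A%:R - 1) (3 / 1) x +
  (- 1) * step_at (- A%:R) (3 / 1) x).

Let converges_tail A : converges (tail A).
Proof. by apply: convergesD => //; apply: convergesD => //; exact: convergesZ. Qed.

Let tail_ge0 A x : 0 <= tail A x.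
Proof.
have /andP[a0 a1] := step_at_itv (A%:R - 1) (3 / 1) x.
by have /andP[b0 b1] := step_at_itv (- A%:R) (3 / 1) x; rewrite /tail; lra.
Qed.

Let tail_ge1 A x : A%:R < `|x| -> 1 <= tail A x.
Proof.
move=> Ax; have /andP[a0 a1] := step_at_itv (A%:R - 1) (3 / 1) x.
have /andP[b0 b1] := step_at_itv (- A%:R) (3 / 1) x; rewrite /tail.
move: Ax; rewrite ltr_normr => /orP[Ax|Ax].
  have -> : step_at (A%:R - 1) (3 / 1) x = 1 by apply: step_at_right; lra.
  by lra.
have -> : step_at (- A%:R) (3 / 1) x = 0 by apply: step_at_left; lra.
by lra.
Qed.

Let tail_eq0 A x : `|x| + 1 <= A%:R -> tail A x = 0.
Proof.
move=> xA; have := ler_norm x; have := ler_norm (- x); rewrite normrN => x1 x2.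
rewrite /tail.
have -> : step_at (A%:R - 1) (3 / 1) x = 0 by apply: step_at_left; lra.
have -> : step_at (- A%:R) (3 / 1) x = 1 by apply: step_at_right; lra.
by lra.
Qed.

Let tail_cvg0 : mean mu (tail A) @[A --> \oo] --> (0 : R).
Proof.
have tb A x : `|tail A x| <= 2.
  rewrite ger0_norm//; have /andP[a0 a1] := step_at_itv (A%:R - 1) (3 / 1) x.
  by have /andP[b0 b1] := step_at_itv (- A%:R) (3 / 1) x; rewrite /tail; lra.
have bt A : bmf (tail A) by have [] := converges_tail A.
have [|||||_ _] := @dominated_convergence _ _ _ mu setT measurableT
  (fun A x => (tail A x)%:E) (cst 0%E) (cst 2%:E).
- by move=> A; apply/measurable_EFinP; exact: (bt A).1.
- exact: measurable_cst.
- apply: aeW => x _; apply: cvg_near_cst; near=> A.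
  congr EFin; apply: tail_eq0; near: A.
  exact: nbhs_infty_ger.
- by apply: (bmf_integrable mu (f := cst 2)); exact: bmf_cst.
- by apply: aeW => x A _; rewrite lee_fin tb.
by rewrite integral0 => /fine_cvg.
Unshelve. all: by end_near. Qed.

(** The interpolation [G] and the error bound [V] are both combinations of steps. Hence replacing
    [g] by [G] costs at most the mean of [V], under the limit law and, for large n, under the law of
    [Y n]. *)
Lemma cvg_in_distribution_step : cvg_in_distribution P Y mu.
Proof.
split=> // g cg [M gM].
have bg : bmf g by split; [exact: continuous_measurable_fun|exists M].
have bgY n : bmf (fun w => g (Y n w)) by exact: bmf_comp.
rewrite -(meanE mu bg).
rewrite (_ : (fun n => 'E_P[g \o Y n])%E =
  EFin \o (fun n => mean P (fun w => g (Y n w)))); last first.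
  by apply/funext => n /=; rewrite unlock meanE.
apply: cvg_EFin; first by near=> n.
apply/(@cvgrPdist_le _ R^o) => e; move: (e : R) => {}e e0.
have M0 : 0 <= M := le_trans (normr_ge0 _) (gM 0).
have eta0 : 0 < e / 16 by rewrite divr_gt0.
have [A tA] : exists A, 2 * M * mean mu (tail A) <= e / 8.
  have M1 : 0 < e / (16 * (M + 1)) by rewrite divr_gt0// mulr_gt0// ltr_wpDl.
  have /(@cvgrPdist_le _ R^o) /(_ _ M1) [A _ /(_ A (leqnn _))] := tail_cvg0.
  rewrite /= sub0r normrN ger0_norm ?mean_ge0// => tA; exists A.
  rewrite (le_trans (ler_wpM2l _ tA)) ?mulr_ge0//.
  rewrite (_ : e / 8 = 2 * (M + 1) * (e / (16 * (M + 1)))); last first.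
    by field; rewrite gt_eqF// ltr_wpDl.
  by rewrite ler_wpM2r ?(ltW M1)//; lra.
have [m m0 gm] := continuous_itv_mesh A%:R cg eta0.
have m0' : 0 < m%:R :> R by rewrite ltr0n.
(* There are 2 A m cells of width 1 / m in [-A, A]. The bound [V] adds twice the mesh error e / 16,
   valid inside, to 2 M times the tail, valid outside; its limiting mean is at most e / 4. *)
pose G := step_interpolation g (- A%:R) m%:R^-1 (2 * A * m).
pose V (x : R) := e / 8 + (2 * M) * tail A x.
have AE : - A%:R + (2 * A * m)%:R * m%:R^-1 = A%:R :> R.
  by rewrite !natrM mulfK ?gt_eqF//; ring.
have GV x : `|g x - G x| <= V x.
  have Vt : 2 * M * tail A x <= V x by rewrite lerDr divr_ge0// ltW.
  have far y z : A%:R < `|y| -> `|g y - g z| <= V y.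
    move=> Ay; rewrite (le_trans (ler_normB _ _))// (le_trans (lerD (gM _) (gM _)))//.
    rewrite /V; have := tail_ge1 Ay => t1.
    have : M <= M * tail A y by rewrite ler_peMr.
    by have := ltW eta0; lra.
  have [xA|Ax] := leP `|x| A%:R.
    rewrite distrC (@le_trans _ _ (2 * (e / 16)))//; last first.
      by rewrite /V -[leLHS]addr0 lerD ?mulr_ge0//; lra.
    apply: step_interpolation_close; rewrite ?invr_gt0//; last first.
      by rewrite AE -ler_norml.
    by move=> y z; rewrite AE -!ler_norml; exact: gm.
  have := Ax; rewrite ltr_normr => /orP[xA|xA].
    by rewrite /G step_interpolation_right ?invr_gt0 ?AE ?(ltW xA)//; exact: far.
  rewrite /G step_interpolation_left ?invr_gt0//; first exact: far.
  by rewrite lerNr ltW.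
have [bG cG] : converges G by exact: converges_interpolation.
have [bV cV] : converges V by apply: convergesD => //; exact: convergesZ.
have VE : mean mu V <= e / 4.
  rewrite meanD; [|exact: bmf_cst|]; last first.
    by apply: bmfM; [exact: bmf_cst|have [] := converges_tail A].
  rewrite mean_cst meanZ; last by have [] := converges_tail A.
  by lra.
have e40 : 0 < e / 4 by rewrite divr_gt0.
near=> n.
have hG : `|mean mu G - mean P (fun w => G (Y n w))| <= e / 4.
  by near: n; move/(@cvgrPdist_le _ R^o) : cG; exact.
have hV : `|mean mu V - mean P (fun w => V (Y n w))| <= e / 4.
  by near: n; move/(@cvgrPdist_le _ R^o) : cV; exact.
have bGY : bmf (fun w => G (Y n w)) by exact: bmf_comp.
have bVY : bmf (fun w => V (Y n w)) by exact: bmf_comp.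
have h1 : `|mean mu g - mean mu G| <= mean mu V.
  rewrite -meanB// (le_trans (norm_mean _ _))//; first exact: bmfB.
  by apply: le_mean => //; apply: bmf_norm; exact: bmfB.
have h2 : `|mean P (fun w => g (Y n w)) - mean P (fun w => G (Y n w))| <=
    mean P (fun w => V (Y n w)).
  rewrite -meanB// (le_trans (norm_mean _ _))//; first exact: bmfB.
  by apply: le_mean => //; apply: bmf_norm; exact: bmfB.
move: hG hV h1 h2 VE; rewrite /= !ler_norml.
do 4!(move=> /andP[? ?]); move=> ?; apply/andP; split; lra.
Unshelve. all: by end_near. Qed.

End criterion.
End weak_convergence.

(** * Two independent samples as one family, and orthogonality of centered kernels *)

Section joint_family.
Context {R : realType} {d d1 d2 : measure_display} {T : measurableType d}.
Context {S1 : measurableType d1} {S2 : measurableType d2}.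
Variables (P : probability T R).
Variables (zeta : nat -> {mfun T >-> S1}) (W : nat -> {mfun T >-> S2}).

Definition joint_display (i : nat + nat) :=
  match i with inl _ => d1 | inr _ => d2 end.

Definition joint_type (i : nat + nat) : measurableType (joint_display i) :=
  match i with inl _ => S1 | inr _ => S2 end.

Definition joint (i : nat + nat) : T -> joint_type i :=
  match i with inl j => zeta j | inr l => W l end.

Lemma measurable_joint i : measurable_fun [set: T] (@joint i).
Proof. by case: i => i /=. Qed.

Section independent.
Hypothesis iX : mutually_independent P [set: nat + nat] joint.

Local Notation sig D := (g_sigma_algebraType (subfamily_events joint D)).

Lemma measurable_sig_zeta D j : D (inl j) -> measurable_fun [set: sig D] (zeta j).
Proof. by move=> Dj; exact: (@subfamily_eventsP _ _ _ _ _ joint D (inl j)). Qed.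

Lemma measurable_sig_W D l : D (inr l) -> measurable_fun [set: sig D] (W l).
Proof. by move=> Dj; exact: (@subfamily_eventsP _ _ _ _ _ joint D (inr l)). Qed.

Lemma mean_joint D1 D2 d' d'' (S' : measurableType d') (S'' : measurableType d'')
    (A : T -> S') (B : T -> S'') (h : S' * S'' -> R) :
  D1 `&` D2 = set0 -> measurable_fun [set: sig D1] A ->
  measurable_fun [set: sig D2] B -> bmf h ->
  mean P (fun w => h (A w, B w)) = mean P (fun w => mean P (fun w' => h (A w, B w'))).
Proof.
move=> D12 mA mB bh; apply: (@decouple_comp _ _ _ P (subfamily_events joint D1)
  (subfamily_events joint D2)) => //.
- by apply: subfamily_events_measurable; exact: measurable_joint.
- by apply: subfamily_events_measurable; exact: measurable_joint.
- exact: (mutually_independent_sigma measurable_joint iX).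
Qed.

Lemma bmf_kernel (h : S1 * S2 -> R) j l : bmf h -> bmf (fun w => h (zeta j w, W l w)).
Proof. by move=> bh; apply: bmf_comp => //; exact: measurable_fun_pair. Qed.

(** The variable [zeta i] is independent of everything else in the product, even when l = m, so it
    can be averaged first, which gives 0. The next lemma averages [W l] in the same way. *)
Lemma kernel_orthogonal1 (h : S1 * S2 -> R) i j l m : bmf h ->
  (forall k t, mean P (fun w => h (zeta k w, t)) = 0) -> i != j ->
  mean P (fun w => h (zeta i w, W l w) * h (zeta j w, W m w)) = 0.
Proof.
move=> bh h0 ij.
pose D1 := [set inl j; inr l; inr m] : set (nat + nat); pose D2 := [set inl i : nat + nat].
pose H (z : (S1 * S2 * S2) * S1) := h (z.2, z.1.1.2) * h (z.1.1.1, z.1.2).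
have m1 : measurable_fun [set: (S1 * S2 * S2) * S1] (fun z => z.1).
  exact: measurable_fst.
have bH : bmf H.
  apply: bmfM; apply: bmf_comp => //; apply: measurable_fun_pair.
  - exact: measurable_snd.
  - apply: measurableT_comp; first exact: measurable_snd.
    exact: measurableT_comp measurable_fst m1.
  - apply: measurableT_comp; first exact: measurable_fst.
    exact: measurableT_comp measurable_fst m1.
  - exact: measurableT_comp measurable_snd m1.
rewrite (_ : (fun w => _) = (fun w => H ((zeta j w, W l w, W m w), zeta i w)))//.
rewrite (@mean_joint D1 D2)//.
- apply: etrans (mean_cst P 0); apply: eq_mean => w; rewrite /H/=.
  under eq_mean do rewrite mulrC.
  rewrite meanZ ?h0 ?mulr0//.
  by apply: (bmf_comp (f := fun z => h (z, W l w))) => //; exact: bmf_section2.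
- apply/seteqP; split=> // x [/=]; case=> [[]|] -> //.
  by move=> [ji]; rewrite ji eqxx in ij.
- apply: measurable_fun_pair; last by apply: measurable_sig_W; right.
  apply: measurable_fun_pair; first by apply: measurable_sig_zeta; left; left.
  by apply: measurable_sig_W; left; right.
- exact: measurable_sig_zeta.
Qed.

Lemma kernel_orthogonal2 (h : S1 * S2 -> R) i j l m : bmf h ->
  (forall k z, mean P (fun w => h (z, W k w)) = 0) -> l != m ->
  mean P (fun w => h (zeta i w, W l w) * h (zeta j w, W m w)) = 0.
Proof.
move=> bh h0 ij.
pose D1 := [set inl i; inl j; inr m] : set (nat + nat); pose D2 := [set inr l : nat + nat].
pose H (z : (S1 * S1 * S2) * S2) := h (z.1.1.1, z.2) * h (z.1.1.2, z.1.2).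
have m1 : measurable_fun [set: (S1 * S1 * S2) * S2] (fun z => z.1).
  exact: measurable_fst.
have bH : bmf H.
  apply: bmfM; apply: bmf_comp => //; apply: measurable_fun_pair.
  - apply: measurableT_comp; first exact: measurable_fst.
    exact: measurableT_comp measurable_fst m1.
  - exact: measurable_snd.
  - apply: measurableT_comp; first exact: measurable_snd.
    exact: measurableT_comp measurable_fst m1.
  - exact: measurableT_comp measurable_snd m1.
rewrite (_ : (fun w => _) = (fun w => H ((zeta i w, zeta j w, W m w), W l w)))//.
rewrite (@mean_joint D1 D2)//.
- apply: etrans (mean_cst P 0); apply: eq_mean => w; rewrite /H/=.
  under eq_mean do rewrite mulrC.
  rewrite meanZ ?h0 ?mulr0//.
  by apply: (bmf_comp (f := fun z => h (zeta i w, z))) => //; exact: bmf_section1.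
- apply/seteqP; split=> // x [/=]; case=> [[]|] -> //.
  by move=> [ji]; rewrite ji eqxx in ij.
- apply: measurable_fun_pair; last by apply: measurable_sig_W; right.
  apply: measurable_fun_pair; first by apply: measurable_sig_zeta; left; left.
  by apply: measurable_sig_zeta; left; right.
- exact: measurable_sig_W.
Qed.

(** Supplies the independence hypothesis of the exchange argument: the partial sum lives on the
    indices below n, the new summand on the index n. *)
Lemma mean_joint_sum (a : S1 -> R) (b : S2 -> R) (n : nat) (t : R) (u : R -> R) :
  bmf a -> bmf b -> bmf u ->
  let Y j w := a (zeta j w) + b (W j w) in
  mean P (fun w => u (t * (\sum_(j < n) Y j w) + t * Y n w)) =
  mean P (fun w => mean P (fun w' => u (t * (\sum_(j < n) Y j w) + t * Y n w'))).
Proof.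
move=> [ma _] [mb _] bu Y.
pose idx (i : nat + nat) := match i with inl j => j | inr j => j end.
pose D1 := [set i | (idx i < n)%N]; pose D2 := [set i | idx i = n].
pose H (z : R * R) := u (t * z.1 + t * z.2).
have bH : bmf H.
  by apply: bmf_comp => //; apply: measurable_funD; apply: measurable_funM.
have mY D j : D (inl j) -> D (inr j) -> measurable_fun [set: sig D] (Y j).
  move=> Dl Dr; apply: measurable_funD.
    by apply: measurableT_comp ma _; exact: measurable_sig_zeta.
  by apply: measurableT_comp mb _; exact: measurable_sig_W.
apply: (@mean_joint D1 D2 _ _ _ _ (fun w => \sum_(j < n) Y j w) (Y n) H) => //.
- by apply/seteqP; split=> // i []; rewrite /D1 /D2/= => + e; rewrite e ltnn.
- by apply: measurable_sum => j; apply: mY; exact: ltn_ord.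
- exact: mY.
Qed.

End independent.
End joint_family.

(** * Second moments of orthogonal sums and auxiliary real facts *)

Section second_moment.
Context {R : realType} {d : measure_display} {T : measurableType d}.
Variable P : probability T R.

Lemma orthogonal_second_moment (I : finType) (F : I -> T -> R) (C : R) :
  (forall i, bmf (F i)) -> (forall i w, `|F i w| <= C) ->
  (forall i j, i != j -> mean P (fun w => F i w * F j w) = 0) ->
  mean P (fun w => (\sum_i F i w) ^+ 2) <= #|I|%:R * C ^+ 2.
Proof.
move=> bF FC ort.
have bFF i j : bmf (fun w => F i w * F j w) by exact: bmfM.
under eq_mean do rewrite expr2 big_distrlr/=.
rewrite mean_sum; last by move=> i; exact: bmf_sum.
rewrite -sum1_card natr_sum mulr_suml; apply: ler_sum => i _.
rewrite mean_sum// (bigD1 i)//= big1 ?addr0; last first.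
  by move=> j ji; rewrite ort// eq_sym.
rewrite mul1r -[leRHS](mean_cst P); apply: le_mean => //; first exact: bmf_cst.
move=> w; rewrite -expr2 -[leLHS]real_normK ?num_real//.
by rewrite lerXn2r ?nnegrE// (le_trans _ (FC i w)).
Qed.

End second_moment.

Lemma inv_measurable (R : realType) : measurable_fun [set: R] (@GRing.inv R).
Proof.
have -> : [set: R] = [set x | x != 0] `|` [set 0].
  apply/seteqP; split=> // x _; have [->|x0] := eqVneq x 0; [by right|by left].
have o0 : open [set x : R | x != 0] by exact: open_neq.
apply/measurable_funU; [exact: open_measurable|exact: measurable_set1|].
split; last exact: measurable_fun_set1.
apply: open_continuous_measurable_fun => // x; rewrite inE/= => x0.
exact: inv_continuous.
Qed.

(** The difference of the two sides is an empirical variance. *)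
Lemma sqr_mean_le (R : realFieldType) n (x : 'I_n -> R) : (0 < n)%N ->
  (n%:R^-1 * \sum_i x i) ^+ 2 <= n%:R^-1 * \sum_i x i ^+ 2.
Proof.
move=> n0; have r0 : 0 < n%:R :> R by rewrite ltr0n.
set m := n%:R^-1 * \sum_i x i.
have : 0 <= \sum_i (x i - m) ^+ 2 by apply: sumr_ge0 => i _; exact: sqr_ge0.
have -> : \sum_i (x i - m) ^+ 2 =
    \sum_i x i ^+ 2 - 2 * m * \sum_i x i + n%:R * m ^+ 2.
  under eq_bigr do rewrite sqrrB.
  rewrite big_split sumrB/= sumr_const card_ord; congr (_ - _ + _).
    rewrite mulr_sumr; apply: eq_bigr => i _; rewrite -mulr_natl; ring.
  by rewrite mulr_natl.
have -> : \sum_i x i = n%:R * m by rewrite /m mulVKf// gt_eqF.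
move=> h; rewrite ler_pdivlMl// -subr_ge0.
by apply: le_trans h _; rewrite le_eqVlt; apply/orP; left; apply/eqP; ring.
Qed.

Lemma cvg_rate (R : realType) (x : nat -> R) (l C : R) :
  (forall n, (0 < n)%N -> `|x n - l| <= C / Num.sqrt n%:R) -> x @ \oo --> l.
Proof.
move=> xC; apply/(@cvgrPdist_le _ R^o) => e; move: (e : R) => {}e e0.
near=> n; have n0 : (0 < n)%N by near: n; exact: nbhs_infty_gt.
rewrite distrC (le_trans (xC _ n0))//.
have r0 : 0 < Num.sqrt n%:R :> R by rewrite sqrtr_gt0 ltr0n.
rewrite ler_pdivrMr// (le_trans (ler_norm C))// mulrC -ler_pdivrMr//.
rewrite -(ger0_norm (_ : 0 <= `|C| / e)) ?divr_ge0 ?(ltW e0)//.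
rewrite -sqrtr_sqr ler_sqrt//; near: n; exact: nbhs_infty_ger.
Unshelve. all: by end_near. Qed.

(** * The central limit theorem for a ratio of two-sample V-statistics *)

Section vstatistic.
Context {R : realType} {d d1 d2 : measure_display} {T : measurableType d}.
Context {S1 : measurableType d1} {S2 : measurableType d2}.
Variables (P : probability T R).
Variables (zeta : nat -> {mfun T >-> S1}) (W : nat -> {mfun T >-> S2}).
Hypothesis iX : mutually_independent P [set: nat + nat] (joint zeta W).
Hypotheses
  (zeta_law : forall j (f : S1 -> R), bmf f ->
    mean P (fun w => f (zeta j w)) = mean P (fun w => f (zeta 0 w)))
  (W_law : forall j (f : S2 -> R), bmf f ->
    mean P (fun w => f (W j w)) = mean P (fun w => f (W 0 w))).
Variables p q : S1 * S2 -> R.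
Hypotheses (bp : bmf p) (bq : bmf q) (p01 : forall z, 0 <= p z <= 1).

Let F t := mean P (fun w => p (zeta 0 w, t)).
Let G t := mean P (fun w => q (zeta 0 w, t)).
Let D := mean P (fun w => F (W 0 w) * (1 - F (W 0 w))).
Let N := mean P (fun w => G (W 0 w) - F (W 0 w) ^+ 2).
Hypothesis D0 : D != 0.
Let S := N / D.

Definition empirical (h : S1 * S2 -> R) n w t := n%:R^-1 * \sum_(j < n) h (zeta j w, t).

Definition num_estimator n w := n%:R^-1 * \sum_(l < n)
  (empirical q n w (W l w) - empirical p n w (W l w) ^+ 2).

Definition den_estimator n w := n%:R^-1 * \sum_(l < n)
  (empirical p n w (W l w) - empirical p n w (W l w) ^+ 2).

Let bmf_mean_zeta (h : S1 * S2 -> R) : bmf h ->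
  bmf (fun t => mean P (fun w => h (zeta 0 w, t))).
Proof.
move=> bh; apply: (@bmf_mean _ _ _ _ _ (fun z => h (zeta 0 z.2, z.1))).
apply: bmf_comp => //; apply: measurable_fun_pair; last exact: measurable_fst.
by apply: measurableT_comp => //; exact: measurable_snd.
Qed.

Let bmf_mean_W (h : S1 * S2 -> R) : bmf h ->
  bmf (fun z => mean P (fun w => h (z, W 0 w))).
Proof.
move=> bh; apply: (@bmf_mean _ _ _ _ _ (fun z => h (z.1, W 0 z.2))).
apply: bmf_comp => //; apply: measurable_fun_pair; first exact: measurable_fst.
by apply: measurableT_comp => //; exact: measurable_snd.
Qed.

Let bmf_empirical (h : S1 * S2 -> R) n l : bmf h ->
  bmf (fun w => empirical h n w (W l w)).
Proof.
move=> bh; apply: bmfM; first exact: bmf_cst.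
by apply: bmf_sum => j; exact: (bmf_kernel zeta W j l bh).
Qed.

Lemma bmf_num_estimator n : bmf (num_estimator n).
Proof.
apply: bmfM; first exact: bmf_cst.
apply: bmf_sum => l; apply: bmfB; first exact: bmf_empirical.
by apply: bmfX; exact: bmf_empirical.
Qed.

Lemma bmf_den_estimator n : bmf (den_estimator n).
Proof.
apply: bmfM; first exact: bmf_cst.
apply: bmf_sum => l; apply: bmfB; first exact: bmf_empirical.
by apply: bmfX; exact: bmf_empirical.
Qed.

Let bF : bmf F. Proof. exact: bmf_mean_zeta. Qed.
Let bG : bmf G. Proof. exact: bmf_mean_zeta. Qed.

Let bFW l : bmf (fun w => F (W l w)). Proof. exact: bmf_comp. Qed.
Let bGW l : bmf (fun w => G (W l w)). Proof. exact: bmf_comp. Qed.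

Let b1 (f : S1 -> R) : bmf f -> bmf (fun z : S1 * S2 => f z.1).
Proof. by move=> bf; apply: bmf_comp => //; exact: measurable_fst. Qed.

Let b2 (f : S2 -> R) : bmf f -> bmf (fun z : S1 * S2 => f z.2).
Proof. by move=> bf; apply: bmf_comp => //; exact: measurable_snd. Qed.

Let F01 t : 0 <= F t <= 1.
Proof.
have bpt : bmf (fun w => p (zeta 0 w, t)).
  by apply: (bmf_comp (f := fun z => p (z, t))) => //; exact: bmf_section2.
apply/andP; split; first by apply: mean_ge0 => w; have /andP[] := p01 (zeta 0 w, t).
rewrite -(mean_cst P 1); apply: le_mean => //; first exact: bmf_cst.
by move=> w; have /andP[] := p01 (zeta 0 w, t).
Qed.

Let D_gt0 : 0 < D.
Proof.
rewrite lt_neqAle eq_sym D0; apply: mean_ge0 => w.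
by have /andP[? ?] := F01 (W 0 w); rewrite mulr_ge0// subr_ge0.
Qed.

Let delta (z : S1 * S2) := p z - F z.2.

Let b_delta : bmf delta. Proof. by apply: bmfB => //; exact: b2. Qed.

Let bmf_zeta (h : S1 * S2 -> R) k t : bmf h -> bmf (fun w => h (zeta k w, t)).
Proof.
move=> bh; apply: (bmf_comp (f := fun z => h (z, t))) => //.
exact: bmf_section2.
Qed.

Let bmf_W (h : S1 * S2 -> R) k z : bmf h -> bmf (fun w => h (z, W k w)).
Proof.
move=> bh; apply: (bmf_comp (f := fun t => h (z, t))) => //.
exact: bmf_section1.
Qed.

Let zeta_lawk (h : S1 * S2 -> R) k t : bmf h ->
  mean P (fun w => h (zeta k w, t)) = mean P (fun w => h (zeta 0 w, t)).
Proof. by move=> bh; apply: (zeta_law k (f := fun z => h (z, t))); exact: bmf_section2. Qed.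

Let W_lawk (h : S1 * S2 -> R) k z : bmf h ->
  mean P (fun w => h (z, W k w)) = mean P (fun w => h (z, W 0 w)).
Proof. by move=> bh; apply: (W_law k (f := fun t => h (z, t))); exact: bmf_section1. Qed.

Let delta_centered k t : mean P (fun w => delta (zeta k w, t)) = 0.
Proof.
rewrite zeta_lawk//; apply: etrans (meanB P (bmf_zeta 0 t bp) (bmf_cst (F t))) _.
by rewrite mean_cst subrr.
Qed.

Let delta_le1 z : `|delta z| <= 1.
Proof.
have /andP[? ?] := p01 z; have /andP[? ?] := F01 z.2.
by rewrite ler_norml /delta; apply/andP; split; lra.
Qed.

Let empirical_delta n w t : (0 < n)%N -> empirical delta n w t = empirical p n w t - F t.
Proof.
move=> n0; rewrite /empirical /delta sumrB/= sumr_const card_ord mulrBr -[F t *+ n]mulr_natl.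
by rewrite mulKf// pnatr_eq0 -lt0n.
Qed.

(** For a fixed W, the n centered terms are orthogonal and bounded by 1, so the factor n^-2 meets
    only n diagonal terms. *)
Let mean_empirical_delta n l : (0 < n)%N ->
  mean P (fun w => empirical delta n w (W l w) ^+ 2) <= n%:R^-1.
Proof.
move=> n0; have r0 : 0 < n%:R :> R by rewrite ltr0n.
have H := @orthogonal_second_moment _ _ _ P 'I_n
  (fun j w => delta (zeta j w, W l w)) 1
  (fun j => bmf_kernel zeta W j l b_delta) (fun j w => delta_le1 _)
  (fun i j ij => kernel_orthogonal1 iX l l b_delta delta_centered ij).
under eq_mean do rewrite /empirical exprMn.
rewrite meanZ; last first.
  by apply: bmfX; apply: bmf_sum => j; exact: (bmf_kernel zeta W j l b_delta).
rewrite (le_trans (ler_wpM2l _ H)) ?exprn_ge0 ?invr_ge0 ?(ltW r0)//.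
by rewrite card_ord expr1n mulr1 expr2 -mulrA mulVf ?mulr1// gt_eqF.
Qed.

Let gamma t := F t - F t ^+ 2 - D.

Let b_gamma : bmf gamma.
Proof. by apply: bmfB; [apply: bmfB => //; exact: bmfX|exact: bmf_cst]. Qed.

Let gamma_centered k : mean P (fun w => gamma (W k w)) = 0.
Proof.
rewrite W_law// /gamma.
have b : bmf (fun w => F (W 0 w) - F (W 0 w) ^+ 2) by apply: bmfB => //; exact: bmfX.
rewrite (meanB P b (bmf_cst D)) mean_cst /D; apply/eqP; rewrite subr_eq0; apply/eqP.
by apply: eq_mean => w; ring.
Qed.

Let b_kernel2 (f : S2 -> R) l : bmf f -> bmf (fun w => f (W l w)).
Proof. by move=> bf; exact: bmf_comp. Qed.

(** Replacing the empirical value y by f = F(W) changes y - y^2 by (y - f)(1 - y - f), whose last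
    factor lies in [-1, 1]; what remains is an average of the centered [gamma (W l)]. *)
Let den_estimator_sqr n w : (0 < n)%N ->
  (den_estimator n w - D) ^+ 2 <=
  2 * (n%:R^-1 * \sum_(l < n) empirical delta n w (W l w) ^+ 2) +
  2 * (n%:R^-1 * \sum_(l < n) gamma (W l w)) ^+ 2.
Proof.
move=> n0; have r0 : 0 < n%:R :> R by rewrite ltr0n.
pose x (l : 'I_n) := empirical p n w (W l w) - empirical p n w (W l w) ^+ 2
  - (F (W l w) - F (W l w) ^+ 2).
have -> : den_estimator n w - D = n%:R^-1 * \sum_(l < n) x l +
    n%:R^-1 * \sum_(l < n) gamma (W l w).
  rewrite -mulrDr -big_split/= /den_estimator -[X in _ - X](mulKf (lt0r_neq0 r0)).
  rewrite -mulrBr; congr (_ * _); rewrite mulr_natl -[X in _ *+ X](card_ord n).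
  rewrite -sumr_const -sumrB; apply: eq_bigr => l _.
  by rewrite /x /gamma; ring.
set a := _ * \sum_l x l; set b := _ * \sum_l gamma _.
have ax : a ^+ 2 <= n%:R^-1 * \sum_(l < n) empirical delta n w (W l w) ^+ 2.
  rewrite (le_trans (sqr_mean_le _ n0))// ler_wpM2l ?invr_ge0 ?(ltW r0)//.
  apply: ler_sum => l _; rewrite empirical_delta// /x.
  set y := empirical p n w _; set f := F _.
  have /andP[f0 f1] : 0 <= f <= 1 by exact: F01.
  have /andP[y0 y1] : 0 <= y <= 1.
    rewrite /y /empirical; apply/andP; split.
      rewrite mulr_ge0 ?invr_ge0 ?(ltW r0)// sumr_ge0// => j _.
      by have /andP[] := p01 (zeta j w, W l w).
    rewrite mulrC ler_pdivrMr// mul1r [leRHS](_ : _ = \sum_(j < n) 1); last first.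
      by rewrite sumr_const card_ord.
    by apply: ler_sum => j _; have /andP[] := p01 (zeta j w, W l w).
  rewrite (_ : y - y ^+ 2 - _ = (y - f) * (1 - y - f)); last by ring.
  rewrite exprMn ler_piMr ?sqr_ge0// -(expr1n _ 2) -[leLHS]real_normK ?num_real//.
  by rewrite lerXn2r ?nnegrE ?ler01// ler_norml; apply/andP; split; lra.
have : 0 <= (a - b) ^+ 2 by exact: sqr_ge0.
by move: ax; nra.
Qed.

Let mean_den_estimator : exists C : R, 0 <= C /\ forall n, (0 < n)%N ->
  mean P (fun w => (den_estimator n w - D) ^+ 2) <= C / n%:R.
Proof.
have [_ [C gC]] := b_gamma; exists (2 + 2 * C ^+ 2); split.
  by have := sqr_ge0 C; lra.
move=> n n0; have r0 : 0 < n%:R :> R by rewrite ltr0n.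
have bd l : bmf (fun w => empirical delta n w (W l w) ^+ 2).
  by apply: bmfX; exact: bmf_empirical.
have bs1 : bmf (fun w => n%:R^-1 * \sum_(l < n) empirical delta n w (W l w) ^+ 2).
  by apply: bmfM; [exact: bmf_cst|exact: bmf_sum].
have bs0 : bmf (fun w => (\sum_(l < n) gamma (W l w)) ^+ 2).
  by apply: bmfX; apply: bmf_sum => l; exact: b_kernel2.
have bs2 : bmf (fun w => (n%:R^-1 * \sum_(l < n) gamma (W l w)) ^+ 2).
  by under eq_fun do rewrite exprMn; apply: bmfM => //; exact: bmf_cst.
have b2' (f : T -> R) : bmf f -> bmf (fun w => 2 * f w).
  by move=> bf; apply: bmfM => //; exact: bmf_cst.
apply: (@le_trans _ _ (mean P (fun w =>
  2 * (n%:R^-1 * \sum_(l < n) empirical delta n w (W l w) ^+ 2) +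
  2 * (n%:R^-1 * \sum_(l < n) gamma (W l w)) ^+ 2))).
  apply: le_mean => [||w]; last exact: den_estimator_sqr.
    by apply: bmfX; apply: bmfB; [exact: bmf_den_estimator|exact: bmf_cst].
  by apply: bmfD; exact: b2'.
rewrite meanD; [|exact: b2'..]; rewrite !meanZ//; last exact: bmf_sum.
rewrite mean_sum// [leRHS]mulrDl; apply: lerD.
  rewrite ler_wpM2l//; rewrite (@le_trans _ _ (n%:R^-1 * \sum_(l < n) n%:R^-1))//.
    rewrite ler_wpM2l ?invr_ge0 ?(ltW r0)//; apply: ler_sum => l _.
    exact: mean_empirical_delta.
  by rewrite sumr_const card_ord -[n%:R^-1 *+ n]mulr_natl mulfV ?mulr1// gt_eqF.
under eq_mean do rewrite exprMn.
rewrite meanZ// -[leRHS]mulrA ler_wpM2l//.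
(* A function of the W's alone is treated as a kernel constant in its first argument; the two zeta
   indices 0 are dummies. *)
have H := @orthogonal_second_moment _ _ _ P 'I_n (fun l w => gamma (W l w)) C
  (fun l => b_kernel2 l b_gamma) (fun j w => gC _)
  (fun i j ij => kernel_orthogonal2 iX 0 0 (b2 b_gamma) (fun k z => gamma_centered k) ij).
rewrite (le_trans (ler_wpM2l _ H)) ?exprn_ge0 ?invr_ge0 ?(ltW r0)//.
rewrite card_ord le_eqVlt; apply/orP; left; apply/eqP.
by field; exact: lt0r_neq0.
Qed.

(* Hoeffding decomposition of [q - S p], with [F ^+ 2] linearised at the empirical
   average: [beta] and [alpha] are its projections on the [W]'s and the [zeta]'s,
   and [kappa] is doubly degenerate. *)
Let phi z := q z - S * p z.
Let Phi t := G t - S * F t.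
Let psi z := phi z - Phi z.2 - 2 * (1 - S) * F z.2 * delta z.
Let alpha x := mean P (fun w => psi (x, W 0 w)).
Let kappa z := psi z - alpha z.1.
Let beta t := Phi t - (1 - S) * F t ^+ 2.

Let bZ d' (U : measurableType d') (r : R) (f : U -> R) :
  bmf f -> bmf (fun x => r * f x).
Proof. by move=> bf; apply: bmfM => //; exact: bmf_cst. Qed.

Let b_phi : bmf phi. Proof. by apply: bmfB => //; exact: bZ. Qed.
Let b_Phi : bmf Phi. Proof. by apply: bmfB => //; exact: bZ. Qed.

Let b_psi : bmf psi.
Proof.
apply: bmfB; first by apply: bmfB => //; exact: b2.
by apply: bmfM => //; apply: bZ; exact: b2.
Qed.

Let b_alpha : bmf alpha. Proof. exact: bmf_mean_W. Qed.
Let b_kappa : bmf kappa. Proof. by apply: bmfB => //; exact: b1. Qed.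
Let b_beta : bmf beta.
Proof. by apply: bmfB => //; apply: bZ; exact: bmfX. Qed.

Let psi_centered k t : mean P (fun w => psi (zeta k w, t)) = 0.
Proof.
rewrite zeta_lawk// /psi.
have bd := bmf_zeta 0 t b_delta; have bh := bmf_zeta 0 t b_phi.
apply: etrans (meanB P (bmfB bh (bmf_cst (Phi t))) (bZ (2 * (1 - S) * F t) bd)) _.
rewrite meanZ// delta_centered mulr0 subr0.
rewrite (meanB P bh (bmf_cst (Phi t))) mean_cst /phi.
rewrite (meanB P (bmf_zeta 0 t bq) (bZ S (bmf_zeta 0 t bp))) meanZ ?subrr//.
exact: bmf_zeta.
Qed.

Let alpha_centered k : mean P (fun w => alpha (zeta k w)) = 0.
Proof.
have bh : bmf (fun z : T * T => psi (zeta k z.1, W 0 z.2)).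
  apply: bmf_comp => //; apply: measurable_fun_pair.
    by apply: measurableT_comp => //; exact: measurable_fst.
  by apply: measurableT_comp => //; exact: measurable_snd.
rewrite /alpha (mean_swap P P bh)/=.
by apply: etrans (mean_cst P 0); apply: eq_mean => w; exact: psi_centered.
Qed.

Let kappa_centered1 k t : mean P (fun w => kappa (zeta k w, t)) = 0.
Proof.
have ba : bmf (fun w => alpha (zeta k w)) by exact: bmf_comp.
rewrite /kappa (meanB P (bmf_zeta k t b_psi) ba).
by rewrite psi_centered alpha_centered subrr.
Qed.

Let kappa_centered2 k x : mean P (fun w => kappa (x, W k w)) = 0.
Proof.
rewrite /kappa (meanB P (bmf_W k x b_psi) (bmf_cst (alpha x))).
by rewrite W_lawk// mean_cst subrr.
Qed.

(** The mean is N - S D, so the centering is exactly the definition of S as a ratio. *)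
Let beta_centered k : mean P (fun w => beta (W k w)) = 0.
Proof.
rewrite W_law//.
have bn : bmf (fun w => G (W 0 w) - F (W 0 w) ^+ 2) by apply: bmfB => //; exact: bmfX.
have bd : bmf (fun w => F (W 0 w) * (1 - F (W 0 w))).
  by apply: bmfM => //; apply: bmfB => //; exact: bmf_cst.
transitivity (mean P (fun w => (G (W 0 w) - F (W 0 w) ^+ 2) -
    S * (F (W 0 w) * (1 - F (W 0 w))))).
  by apply: eq_mean => w; rewrite /beta /Phi; ring.
by rewrite (meanB P bn (bZ S bd)) meanZ// /S divfK// subrr.
Qed.

(** Both samples have the same size, so their projections can be paired at equal index into one
    sequence of independent summands. The factor [D^-1] anticipates the division by the
    denominator. *)
Let y (z : S1 * S2) := D^-1 * alpha z.1 + D^-1 * beta z.2.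
Let Y j w := D^-1 * alpha (zeta j w) + D^-1 * beta (W j w).

Let bY j : bmf (Y j).
Proof. by apply: bmfD; apply: bZ; exact: bmf_comp. Qed.

Let Y_bounded : exists C : R, 0 <= C /\ forall j w, `|Y j w| <= C.
Proof.
have by_ : bmf y by apply: bmfD; apply: bZ; [exact: b1|exact: b2].
have [_ [C yC]] := by_; exists C; split; last by move=> j w; exact: (yC (zeta j w, W j w)).
exact: le_trans (normr_ge0 _) (yC (zeta 0 point, W 0 point)).
Qed.

Let Y_centered j : mean P (Y j) = 0.
Proof.
have ba : bmf (fun w => alpha (zeta j w)) by exact: bmf_comp.
have bb : bmf (fun w => beta (W j w)) by exact: bmf_comp.
by rewrite (meanD P (bZ _ ba) (bZ _ bb)) !meanZ// alpha_centered beta_centered !mulr0 addr0.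
Qed.

(** Independence of [zeta j] and [W j] expresses the second moment through the two marginal laws,
    which can then be changed to index 0 one at a time. *)
Let Y_variance j : mean P (fun w => Y j w ^+ 2) = mean P (fun w => Y 0 w ^+ 2).
Proof.
have by_ : bmf y by apply: bmfD; apply: bZ; [exact: b1|exact: b2].
have by2 : bmf (fun z => y z ^+ 2) by exact: bmfX.
have E k : mean P (fun w => Y k w ^+ 2) =
    mean P (fun w => mean P (fun w' => y (zeta k w, W k w') ^+ 2)).
  apply: (@mean_joint _ _ _ _ _ _ _ P zeta W iX [set inl k] [set inr k] _ _ _ _
    (zeta k) (W k) (fun z => y z ^+ 2)) => //.
  - by apply/seteqP; split => // x [/= ->].
  - exact: measurable_sig_zeta.
  - exact: measurable_sig_W.
apply: etrans (E j) _; apply: etrans (esym (E 0)).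
transitivity (mean P (fun w => mean P (fun w' => y (zeta j w, W 0 w') ^+ 2))).
  by apply: eq_mean => w; rewrite (W_lawk j (zeta j w) by2).
apply: (zeta_law j (f := fun x => mean P (fun w => y (x, W 0 w) ^+ 2))).
exact: bmf_mean_W by2.
Qed.

Let rem n w := n%:R ^- 2 * (\sum_(i : 'I_n * 'I_n) kappa (zeta i.2 w, W i.1 w)) -
  (1 - S) * (n%:R^-1 * \sum_(l < n) empirical delta n w (W l w) ^+ 2).

Let empirical_psi n w t : (0 < n)%N -> empirical psi n w t =
  empirical q n w t - S * empirical p n w t - Phi t -
  2 * (1 - S) * F t * empirical delta n w t.
Proof.
move=> n0; have r0 : n%:R != 0 :> R by rewrite pnatr_eq0 -lt0n.
rewrite /empirical; set d_ := \sum_(j < n) delta _.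
have -> : \sum_(j < n) psi (zeta j w, t) = \sum_(j < n) q (zeta j w, t) -
    S * \sum_(j < n) p (zeta j w, t) - n%:R * Phi t - 2 * (1 - S) * F t * d_.
  rewrite /d_ !mulr_sumr mulr_natl -[X in _ *+ X](card_ord n) -sumr_const -!sumrB.
  by apply: eq_bigr.
by field.
Qed.

Let decomposition n w : (0 < n)%N -> num_estimator n w - S * den_estimator n w =
  D * (n%:R^-1 * \sum_(j < n) Y j w) + rem n w.
Proof.
move=> n0; have r0 : n%:R != 0 :> R by rewrite pnatr_eq0 -lt0n.
have kE : n%:R ^- 2 * (\sum_(i : 'I_n * 'I_n) kappa (zeta i.2 w, W i.1 w)) =
    n%:R^-1 * (\sum_(l < n) empirical psi n w (W l w)) -
    n%:R^-1 * \sum_(j < n) alpha (zeta j w).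
  rewrite -(pair_bigA _ (fun l j : 'I_n => kappa (zeta j w, W l w)))/=.
  rewrite /empirical -mulr_sumr /kappa/=.
  under eq_bigr do rewrite sumrB.
  rewrite sumrB sumr_const card_ord -[X in _ - X]mulr_natl.
  by field.
have yE : \sum_(j < n) Y j w =
    D^-1 * (\sum_(j < n) alpha (zeta j w) + \sum_(j < n) beta (W j w)).
  by rewrite mulrDr !mulr_sumr -big_split.
(* With p_n the empirical average and delta_n its error, p_n^2 = F^2 + 2 F delta_n + delta_n^2: the
   first term goes into [beta], the second into [psi], and the square is left over. *)
have lE : \sum_(l < n) (empirical q n w (W l w) - empirical p n w (W l w) ^+ 2) -
    S * \sum_(l < n) (empirical p n w (W l w) - empirical p n w (W l w) ^+ 2) =
    \sum_(l < n) beta (W l w) + \sum_(l < n) empirical psi n w (W l w) -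
    (1 - S) * \sum_(l < n) empirical delta n w (W l w) ^+ 2.
  rewrite !mulr_sumr -big_split -!sumrB/=; apply: eq_bigr => l _.
  by rewrite empirical_psi// empirical_delta// /beta; ring.
rewrite /rem kE yE /num_estimator /den_estimator mulrCA -mulrBr lE.
by field; rewrite r0 D0.
Qed.

Let mean_rem : exists C : R, 0 <= C /\ forall n, (0 < n)%N ->
  bmf (rem n) /\ mean P (fun w => `|rem n w|) <= C / n%:R.
Proof.
have [_ [C kC]] := b_kappa; exists ((1 + C ^+ 2) / 2 + `|1 - S|); split.
  by have := sqr_ge0 C; have := normr_ge0 (1 - S); lra.
move=> n n0; have r0 : 0 < n%:R :> R by rewrite ltr0n.
pose K w := \sum_(i : 'I_n * 'I_n) kappa (zeta i.2 w, W i.1 w).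
pose E w := n%:R^-1 * \sum_(l < n) empirical delta n w (W l w) ^+ 2.
have bK : bmf K by apply: bmf_sum => i; exact: (bmf_kernel zeta W _ _ b_kappa).
have bEl l : bmf (fun w => empirical delta n w (W l w) ^+ 2).
  by apply: bmfX; exact: bmf_empirical.
have bE : bmf E by apply: bZ; exact: bmf_sum.
have bR : bmf (rem n) by apply: bmfB; exact: bZ.
split=> //.
have K2 : mean P (fun w => K w ^+ 2) <= n%:R ^+ 2 * C ^+ 2.
  have := @orthogonal_second_moment _ _ _ P ('I_n * 'I_n)%type
    (fun i w => kappa (zeta i.2 w, W i.1 w)) C
    (fun i => bmf_kernel zeta W i.2 i.1 b_kappa) (fun i w => kC _).
  rewrite card_prod card_ord natrM -expr2; apply=> -[l j] [l' j'].
  rewrite xpair_eqE negb_and => /orP[ll|jj].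
    exact: (kernel_orthogonal2 iX _ _ b_kappa kappa_centered2).
  exact: (kernel_orthogonal1 iX _ _ b_kappa kappa_centered1).
have E1 : mean P E <= n%:R^-1.
  rewrite meanZ; last exact: bmf_sum.
  rewrite mean_sum// ler_pdivrMl// mulfV ?gt_eqF//.
  rewrite [leRHS](_ : _ = \sum_(l < n) n%:R^-1); last first.
    by rewrite sumr_const card_ord -[n%:R^-1 *+ n]mulr_natl mulfV// gt_eqF.
  by apply: ler_sum => l _; exact: mean_empirical_delta.
(* From second to first moment by AM-GM: |K| / n^2 <= 1 / (2 n) + K^2 / (2 n^3). The second moment
   of the double sum is only of order n^2, because distinct pairs of indices are orthogonal in at
   least one of the two variables. *)
apply: (@le_trans _ _ (mean P (fun w => (2 * n%:R)^-1 +
   ((2 * n%:R ^+ 3)^-1 * K w ^+ 2 + `|1 - S| * E w)))).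
  apply: le_mean => [||w]; first exact: bmf_norm.
    apply: bmfD; first exact: bmf_cst.
    by apply: bmfD; apply: bZ => //; exact: bmfX.
  rewrite /rem -/(K w) -/(E w) (le_trans (ler_normB _ _))// addrA lerD//; last first.
    rewrite normrM ler_wpM2l// ger0_norm// mulr_ge0 ?invr_ge0 ?(ltW r0)//.
    by apply: sumr_ge0 => l _; exact: sqr_ge0.
  rewrite normrM ger0_norm ?invr_ge0 ?exprn_ge0 ?(ltW r0)//.
  rewrite -subr_ge0 -(@real_normK _ (K w)) ?num_real//.
  rewrite (_ : _ - _ = (2 * n%:R ^+ 3)^-1 * (n%:R - `|K w|) ^+ 2); last first.
    by field; exact: lt0r_neq0.
  by rewrite mulr_ge0 ?sqr_ge0// invr_ge0 mulr_ge0// exprn_ge0// ltW.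
rewrite meanD; [|exact: bmf_cst|]; last first.
  by apply: bmfD; apply: bZ => //; exact: bmfX.
rewrite (meanD P (bZ _ (bmfX 2 bK)) (bZ _ bE)) (meanZ P _ (bmfX 2 bK)) (meanZ P _ bE).
rewrite mean_cst.
have i0 : 0 <= (2 * n%:R ^+ 3)^-1 :> R.
  by rewrite invr_ge0 mulr_ge0// exprn_ge0// ltW.
have h1 := ler_wpM2l i0 K2.
have h2 := ler_wpM2l (normr_ge0 (1 - S)) E1.
rewrite (le_trans (lerD (lexx _) (lerD h1 h2)))// le_eqVlt; apply/orP; left; apply/eqP.
by field; exact: lt0r_neq0.
Qed.

Let L n w := (Num.sqrt n%:R)^-1 * \sum_(j < n) Y j w.

Let bL n : bmf (L n). Proof. by apply: bZ; exact: bmf_sum. Qed.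

(** Controls L in its product with the error of the denominator. The zeta part and the W part are
    bounded separately, each as an orthogonal sum. *)
Let mean_L : exists C : R, 0 <= C /\ forall n, (0 < n)%N ->
  mean P (fun w => L n w ^+ 2) <= C.
Proof.
have [_ [A aA]] := b_alpha; have [_ [B bB]] := b_beta.
exists (D^-1 ^+ 2 * 2 * (A ^+ 2 + B ^+ 2)); split.
  by rewrite mulr_ge0 ?addr_ge0 ?sqr_ge0// mulr_ge0 ?sqr_ge0.
move=> n n0; have r0 : 0 < n%:R :> R by rewrite ltr0n.
pose SA w := \sum_(j < n) alpha (zeta j w); pose SB w := \sum_(j < n) beta (W j w).
have bSA : bmf SA by apply: bmf_sum => j; exact: bmf_comp.
have bSB : bmf SB by apply: bmf_sum => j; exact: bmf_comp.
have hA := @orthogonal_second_moment _ _ _ P 'I_n (fun l w => alpha (zeta l w)) A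
  (fun l => bmf_kernel zeta W l 0 (b1 b_alpha)) (fun j w => aA _)
  (fun i j ij => kernel_orthogonal1 iX 0 0 (b1 b_alpha) (fun k t => alpha_centered k) ij).
have hB := @orthogonal_second_moment _ _ _ P 'I_n (fun l w => beta (W l w)) B
  (fun l => b_kernel2 l b_beta) (fun j w => bB _)
  (fun i j ij => kernel_orthogonal2 iX 0 0 (b2 b_beta) (fun k z => beta_centered k) ij).
rewrite card_ord in hA; rewrite card_ord in hB.
have c0 : 0 <= D^-1 ^+ 2 * 2 / n%:R :> R.
  by rewrite mulr_ge0 ?invr_ge0 ?(ltW r0)// mulr_ge0// sqr_ge0.
apply: (@le_trans _ _ (mean P (fun w => D^-1 ^+ 2 * 2 / n%:R *
   (SA w ^+ 2 + SB w ^+ 2)))).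
  apply: le_mean => [||w]; first exact: bmfX.
    by apply: bZ; apply: bmfD; exact: bmfX.
  have -> : L n w ^+ 2 = D^-1 ^+ 2 / n%:R * (SA w + SB w) ^+ 2.
    pose r : R := Num.sqrt n%:R; have rr : r ^+ 2 = n%:R by rewrite sqr_sqrtr// ltW.
    have r0' : r != 0 by rewrite gt_eqF// sqrtr_gt0.
    rewrite /L -/r (_ : \sum_(j < n) Y j w = D^-1 * (SA w + SB w)); last first.
      by rewrite mulrDr !mulr_sumr -big_split.
    by rewrite -rr; field; rewrite D0 r0'.
  rewrite (_ : _ * 2 / n%:R * _ = D^-1 ^+ 2 / n%:R * (2 * (SA w ^+ 2 + SB w ^+ 2))); last by ring.
  have cc : 0 <= D^-1 ^+ 2 / n%:R by rewrite divr_ge0 ?sqr_ge0 ?ltW.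
  rewrite (ler_wpM2l cc)// -subr_ge0 (_ : _ - _ = (SA w - SB w) ^+ 2) ?sqr_ge0//.
  by ring.
rewrite meanZ; last by apply: bmfD; exact: bmfX.
rewrite (meanD P (bmfX 2 bSA) (bmfX 2 bSB)).
rewrite (le_trans (ler_wpM2l c0 (lerD hA hB)))// le_eqVlt; apply/orP; left; apply/eqP.
by field; rewrite D0; exact: lt0r_neq0.
Qed.

Variable c : R.

Definition ratio_estimator n w :=
  if den_estimator n w == 0 then c else num_estimator n w / den_estimator n w.

Let W' n w := Num.sqrt n%:R * (ratio_estimator n w - S).

Let mW' n : measurable_fun [set: T] (W' n).
Proof.
apply: measurable_funM => //; apply: measurable_funB => //.
have [mden _] := bmf_den_estimator n; have [mnum _] := bmf_num_estimator n.
apply: measurable_fun_ifT => //.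
  exact: measurable_fun_eqr.
apply: measurable_funM => //; apply: measurableT_comp mden.
exact: inv_measurable.
Qed.

(** If the denominator is below D / 2, then 4 (den - D)^2 / D^2 >= 1 already bounds the difference;
    this also covers the value [c]. Otherwise the decomposition gives W' - L = (L (D - den) + sqrt n
    rem) / den with 1 / den <= 2 / D, and the Lipschitz bound applies. Every term on the right has
    mean O(1 / sqrt n). *)
Let pointwise_bound (u : R -> R) (Lip : R) n w : 0 <= Lip ->
  (forall x, 0 <= u x <= 1) -> (forall x z, `|u z - u x| <= Lip * `|z - x|) ->
  (0 < n)%N ->
  let r := Num.sqrt n%:R in
  `|u (W' n w) - u (L n w)| <=
  Lip / D * r^-1 * L n w ^+ 2 + (Lip / D * r + 4 / D ^+ 2) * (den_estimator n w - D) ^+ 2 +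
  Lip * 2 / D * r * `|rem n w|.
Proof.
move=> Lip0 u01 uLip n0; cbv zeta; set r : R := Num.sqrt n%:R.
have n0' : 0 < n%:R :> R by rewrite ltr0n.
have r0 : 0 < r by rewrite sqrtr_gt0.
have rr : r ^+ 2 = n%:R by rewrite sqr_sqrtr// ltW.
set x := den_estimator n w.
have t1 : 0 <= Lip / D * r^-1 * L n w ^+ 2.
  by rewrite mulr_ge0 ?sqr_ge0// mulr_ge0 ?invr_ge0 ?(ltW r0)// divr_ge0// ltW.
have t2 : 0 <= Lip / D * r * (x - D) ^+ 2.
  by rewrite mulr_ge0 ?sqr_ge0// mulr_ge0 ?(ltW r0)// divr_ge0// ltW.
have t3 : 0 <= 4 / D ^+ 2 * (x - D) ^+ 2.
  by rewrite mulr_ge0 ?sqr_ge0// divr_ge0// sqr_ge0.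
have t4 : 0 <= Lip * 2 / D * r * `|rem n w|.
  by rewrite mulr_ge0// mulr_ge0 ?(ltW r0)// divr_ge0 ?(ltW D_gt0)// mulr_ge0.
have [xD|xD] := leP (D / 2) x; last first.
  have : `|u (W' n w) - u (L n w)| <= 1.
    have /andP[? ?] := u01 (W' n w); have /andP[? ?] := u01 (L n w).
    by rewrite ler_norml; apply/andP; split; lra.
  have : 1 <= 4 / D ^+ 2 * (x - D) ^+ 2.
    rewrite mulrAC ler_pdivlMr ?exprn_gt0// mul1r.
    by have := D_gt0; nra.
  by rewrite mulrDl; lra.
have x0 : 0 < x by rewrite (lt_le_trans _ xD)// divr_gt0.
have WL : W' n w - L n w = (L n w * (D - x) + r * rem n w) / x.
  rewrite /W' /ratio_estimator -/x gt_eqF//.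
  have := decomposition w n0; rewrite -/x => dec.
  have num : num_estimator n w = S * x + D * (n%:R^-1 * \sum_(j < n) Y j w) + rem n w.
    by move: dec; lra.
  rewrite num /L -/r -rr; field.
  by rewrite (gt_eqF x0) (gt_eqF r0).
rewrite (le_trans (uLip _ _))// WL normrM normfV (gtr0_norm x0).
(* AM-GM: [2 a e <= a^2 / r + r e^2] *)
have h : `|L n w * (D - x) + r * rem n w| <=
    (r^-1 * L n w ^+ 2 + r * (x - D) ^+ 2) / 2 + r * `|rem n w|.
  rewrite (le_trans (ler_normD _ _))// (normrM r) (gtr0_norm r0) lerD2r.
  rewrite normrM (distrC D) -(real_normK (num_real (L n w))) -(real_normK (num_real (x - D))).
  set a := `|L n w|; set e := `|x - D|.
  rewrite -subr_ge0 (_ : _ - _ = (2 * r)^-1 * (a - r * e) ^+ 2); last first.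
    by field; exact: lt0r_neq0.
  by rewrite mulr_ge0 ?sqr_ge0// invr_ge0 mulr_ge0// ltW.
have ix : x^-1 <= 2 / D.
  by rewrite -[leRHS]invrK lef_pV2 ?posrE// ?invr_gt0 ?divr_gt0// invf_div.
have hn : 0 <= (r^-1 * L n w ^+ 2 + r * (x - D) ^+ 2) / 2 + r * `|rem n w|.
  by rewrite (le_trans _ h).
have ix0 : 0 <= x^-1 by rewrite invr_ge0 ltW.
rewrite (le_trans (ler_wpM2l Lip0 (ler_pM (normr_ge0 _) ix0 h ix)))//.
rewrite [leRHS](_ : _ = Lip * (((r^-1 * L n w ^+ 2 + r * (x - D) ^+ 2) / 2 +
   r * `|rem n w|) * (2 / D)) + 4 / D ^+ 2 * (x - D) ^+ 2); last first.
  by field; rewrite (gt_eqF r0) D0.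
by rewrite lerDl.
Qed.

Lemma vstatistic_clt : exists s : R, 0 <= s /\
  cvg_in_distribution P (fun n w => Num.sqrt n%:R * (ratio_estimator n w - S))
    (centered_gaussian s).
Proof.
have [CY [CY0 YC]] := Y_bounded.
have [C1 hC1] := @clt _ _ _ P Y CY (mean P (fun w => Y 0 w ^+ 2))
  (fun n => (bY n).1) YC Y_centered Y_variance
  (fun n t u bu => mean_joint_sum iX n t (bZ D^-1 b_alpha) (bZ D^-1 b_beta) bu).
set s := Num.sqrt _ in hC1; exists s; split; first exact: sqrtr_ge0.
apply: cvg_in_distribution_step; first exact: mW'.
move=> a k; have [K sK] := smooth_step_at a k.
set u := step_at a k in sK *.
have bu : bmf u by exact: bmf_step_at.
have u01 x : 0 <= u x <= 1 by exact: step_at_itv.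
have u1 x : `|u x| <= 1 by have /andP[? ?] := u01 x; rewrite ger0_norm.
have [u' [u'' [_ _ tu]]] := sK.
have K0 := taylor2_ge0 tu.
have uLip := taylor2_lipschitz u1 tu.
set Lip : R := 6 * 1 + 4 * K in uLip.
have Lip0 : 0 <= Lip by rewrite /Lip; lra.
have [CD [CD0 hD]] := mean_den_estimator.
have [CR [CR0 hR]] := mean_rem.
have [CL [CL0 hL]] := mean_L.
pose C := K * C1 + Lip / D * CL + (Lip / D + 4 / D ^+ 2) * CD + Lip * 2 / D * CR.
apply: (@cvg_rate _ _ _ C) => n n0.
have n0' : 0 < n%:R :> R by rewrite ltr0n.
set r : R := Num.sqrt n%:R.
have r0 : 0 < r by rewrite sqrtr_gt0.
have rr : n%:R = r ^+ 2 by rewrite sqr_sqrtr// ltW.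
have r1 : 1 <= r by rewrite -sqrtr1 ler_sqrt// ler1n.
have bW : bmf (fun w => u (W' n w)) by exact: bmf_comp.
have bLn : bmf (fun w => u (L n w)) by apply: bmf_comp => //; exact: (bL n).1.
have [bR hRn] := hR n n0.
have bL2 : bmf (fun w => L n w ^+ 2) by exact: bmfX.
have bD2 : bmf (fun w => (den_estimator n w - D) ^+ 2).
  by apply: bmfX; apply: bmfB; [exact: bmf_den_estimator|exact: bmf_cst].
have bR1 : bmf (fun w => `|rem n w|) by exact: bmf_norm.
have step1 : `|mean P (fun w => u (W' n w)) - mean P (fun w => u (L n w))| <=
    Lip / D * r^-1 * CL + (Lip / D * r + 4 / D ^+ 2) * (CD / n%:R) +
    Lip * 2 / D * r * (CR / n%:R).
  rewrite -meanB// (le_trans (norm_mean _ (bmfB bW bLn)))//.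
  apply: (@le_trans _ _ (mean P (fun w => Lip / D * r^-1 * L n w ^+ 2 +
    (Lip / D * r + 4 / D ^+ 2) * (den_estimator n w - D) ^+ 2 +
    Lip * 2 / D * r * `|rem n w|))).
    apply: le_mean => [||w]; first by apply: bmf_norm; exact: bmfB.
      by apply: bmfD; [apply: bmfD|]; exact: bZ.
    exact: pointwise_bound.
  rewrite (meanD P (bmfD (bZ _ bL2) (bZ _ bD2)) (bZ _ bR1)).
  rewrite (meanD P (bZ _ bL2) (bZ _ bD2)).
  rewrite (meanZ P _ bL2) (meanZ P _ bD2) (meanZ P _ bR1).
  have LD0 : 0 <= Lip / D by rewrite divr_ge0// ltW.
  rewrite lerD// ?lerD// ler_wpM2l// ?hL// ?hD//.
  - by rewrite mulr_ge0 ?invr_ge0// ltW.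
  - by apply: addr_ge0; [rewrite mulr_ge0// ltW|rewrite divr_ge0// sqr_ge0].
  - by rewrite mulr_ge0 ?(ltW r0)// divr_ge0 ?(ltW D_gt0)// mulr_ge0.
have step2 := hC1 K u n bu sK (fun x => (andP (u01 x)).1) n0.
rewrite -(subrKA (mean P (fun w => u (L n w)))) (le_trans (ler_normD _ _))//.
rewrite (le_trans (lerD step1 step2))// -/r rr -subr_ge0.
(* All contributions match the rate 1 / r exactly except the Chebyshev one, which is of order 1 /
   r^2 and is absorbed because r >= 1. *)
rewrite (_ : _ - _ = 4 / D ^+ 2 * CD * ((r - 1) / r ^+ 2)); last first.
  by rewrite /C; field; rewrite D0 (gt_eqF r0).
by rewrite !mulr_ge0// ?invr_ge0 ?sqr_ge0// subr_ge0.
Qed.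

End vstatistic.

(** * From two independent families to one mutually independent family *)

Section independence_of_families.
Context {R : realType} {d : measure_display} {T : measurableType d}.
Variable P : probability T R.

Lemma mutually_independent_seq (I : choiceType) (D : set I)
    (dU : I -> measure_display) (U : forall i, measurableType (dU i))
    (X : forall i, T -> U i) (s : seq I) (A : forall i, set (U i)) :
  mutually_independent P D X -> uniq s -> (forall i, i \in s -> D i) ->
  (forall i, i \in s -> measurable (A i)) ->
  (P (\bigcap_(i in [set` s]) (X i @^-1` A i)) = \prod_(i <- s) P (X i @^-1` A i))%E.
Proof.
move=> iX us sD mA; pose J := [fset i in s]%fset.
have JE i : (i \in J) = (i \in s) by rewrite in_fset.
have sJ : perm_eq s J by apply: uniq_perm => // [|i]; rewrite ?fset_uniq ?JE.
rewrite (perm_big _ sJ) -(iX J).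
- by congr (P _); apply: eq_bigcapl; split=> i /=; rewrite JE.
- by move=> i /=; rewrite JE; exact: sD.
- by move=> i; rewrite JE; exact: mA.
Qed.

Section two_families.
Context {d1 d2 : measure_display} {S1 : measurableType d1} {S2 : measurableType d2}.
Variables (zeta : nat -> {mfun T >-> S1}) (W : nat -> {mfun T >-> S2}).

Let cylinder_family d' (S : measurableType d') (X : nat -> T -> S) (s : seq nat)
    (A : nat -> set S) : (forall j, j \in s -> measurable (A j)) ->
  family_sigma_algebra X (\bigcap_(j in [set` s]) (X j @^-1` A j)).
Proof.
move=> mA; rewrite /family_sigma_algebra.
suff : measurable (\bigcap_(j in [set` s]) (X j @^-1` A j) :
  set (g_sigma_algebraType (family_events X))) by [].
apply: fin_bigcap_measurable => // j js; apply: sub_sigma_algebra.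
by exists j => //; exists (A j); [exact: mA|rewrite setTI].
Qed.

Lemma mutually_independent_joint :
  mutually_independent P [set: nat] zeta -> mutually_independent P [set: nat] W ->
  independent_families P zeta W ->
  mutually_independent P [set: nat + nat] (joint zeta W).
Proof.
move=> iz iW izW J _ A mA.
pose l (i : nat + nat) := if i is inl j then Some j else None.
pose r (i : nat + nat) := if i is inr j then Some j else None.
pose s1 := pmap l J; pose s2 := pmap r J.
have s1P j : (j \in s1) = (inl j \in J).
  rewrite /s1 mem_pmap; apply/mapP/idP => [[[k|k] kJ]//= [->]//|jJ].
  by exists (inl j).
have s2P j : (j \in s2) = (inr j \in J).
  rewrite /s2 mem_pmap; apply/mapP/idP => [[[k|k] kJ]//= [->]//|jJ].
  by exists (inr j).
have u1 : uniq s1 by apply: (@pmap_uniq _ _ l inl); [case|exact: fset_uniq].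
have u2 : uniq s2 by apply: (@pmap_uniq _ _ r inr); [case|exact: fset_uniq].
pose A1 j : set S1 := A (inl j); pose A2 j : set S2 := A (inr j).
have mA1 j : j \in s1 -> measurable (A1 j) by rewrite s1P => /mA.
have mA2 j : j \in s2 -> measurable (A2 j) by rewrite s2P => /mA.
have -> : \bigcap_(i in [set` J]) (joint zeta W i @^-1` A i) =
    \bigcap_(j in [set` s1]) (zeta j @^-1` A1 j) `&`
    \bigcap_(j in [set` s2]) (W j @^-1` A2 j).
  apply/seteqP; split=> w.
    move=> Jw; split=> j /=; first by rewrite s1P => /(Jw (inl j)).
    by rewrite s2P => /(Jw (inr j)).
  by move=> [w1 w2] [j|j] /= jJ; [apply: w1|apply: w2] => /=; rewrite ?s1P ?s2P.
rewrite izW; [|exact: cylinder_family..].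
rewrite (mutually_independent_seq iz u1)// (mutually_independent_seq iW u2)//.
rewrite (perm_big ([seq inl j | j <- s1] ++ [seq inr j | j <- s2])) ?big_cat ?big_map//=.
apply: uniq_perm; first exact: fset_uniq.
  rewrite cat_uniq !map_inj_uniq ?u1 ?u2 ?andbT//=; last 2 first.
  - by move=> x y [].
  - by move=> x y [].
  by apply/hasPn => _ /mapP[j _ ->]; apply/negP => /mapP[].
move=> [j|j]; rewrite mem_cat.
  rewrite mem_map ?s1P; last by move=> x y [].
  by case: (inl j \in J) => //=; apply/esym/negP => /mapP[].
rewrite [X in _ || X]mem_map ?s2P; last by move=> x y [].
by case: (inr j \in J); rewrite ?orbT ?orbF//; apply/esym/negP => /mapP[].
Qed.

End two_families.
End independence_of_families.

(** * Indicators of the componentwise order *)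

Section indicators.
Context {R : realType} {k : nat}.
Local Notation V := (k.-tuple R).

Lemma ind_le01 (s t : V) : 0 <= ind_le s t <= 1.
Proof. by rewrite /ind_le; case: le_vec; rewrite ?lexx ?ler01. Qed.

Lemma bmf_ind_le : bmf (fun z : V * V => ind_le z.1 z.2).
Proof.
split; last first.
  by exists 1 => z; have /andP[? ?] := ind_le01 z.1 z.2; rewrite ger0_norm.
rewrite (_ : (fun z => _) = fun z : V * V => \prod_(i < k)
    (if tnth z.1 i <= tnth z.2 i then 1 else 0)); last first.
  apply/funext => z; rewrite /ind_le; have [/forallP z12|] := boolP (le_vec _ _).
    by rewrite big1// => i _; rewrite z12.
  by rewrite negb_forall => /existsP[i /negbTE zi]; rewrite (bigD1 i)//= zi mul0r.
apply: measurable_prod => i _; apply: measurable_fun_ifT => //.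
apply: measurable_fun_ler.
  exact: measurableT_comp (measurable_tnth i) measurable_fst.
exact: measurableT_comp (measurable_tnth i) measurable_snd.
Qed.

Lemma bmf_ind_le_comp d1 (S : measurableType d1) (g h : S -> V) :
  measurable_fun [set: S] g -> measurable_fun [set: S] h ->
  bmf (fun x => ind_le (g x) (h x)).
Proof.
move=> mg mh; apply: (bmf_comp (f := fun z => ind_le z.1 z.2) (g := fun x => (g x, h x))).
  exact: bmf_ind_le.
exact: measurable_fun_pair.
Qed.

Lemma measurable_le_vec d1 (S : measurableType d1) (g : S -> V) t :
  measurable_fun [set: S] g -> measurable [set x | le_vec (g x) t].
Proof.
move=> mg; have [mi _] := bmf_ind_le_comp mg (measurable_cst t).
rewrite (_ : [set x | _] = (fun x => ind_le (g x) t) @^-1` [set 1]).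
  by rewrite -[X in measurable X]setTI; exact: mi.
apply/seteqP; split=> w /=; rewrite /ind_le; case: le_vec => //.
by move=> /esym/eqP; rewrite oner_eq0.
Qed.

Lemma indic_le_vec (S : Type) (g : S -> V) t :
  \1_[set x | le_vec (g x) t] = (fun x => ind_le (g x) t).
Proof.
apply/funext => x; rewrite indicE /ind_le; case: (boolP (le_vec _ _)) => l.
  by rewrite mem_set.
by rewrite memNset//=; exact/negP.
Qed.

End indicators.

Lemma bmf_indic (R : realType) d (T : measurableType d) (A : set T) :
  measurable A -> bmf (\1_A : T -> R).
Proof.
move=> mA; split; first exact: measurable_indic.
by exists 1 => w; rewrite indicE; case: (_ \in _); rewrite ?normr1 ?normr0.
Qed.

Lemma mean_indic (R : realType) d (T : measurableType d) (P : probability T R)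
  (A : set T) : measurable A -> (mean P \1_A)%:E = P A.
Proof.
move=> mA; rewrite meanE; last exact: bmf_indic.
by rewrite integral_indic// setIT.
Qed.

(** * Laws on the space of inputs *)

Section product_space_theory.
Context {R : realType} {n : nat} {dE : 'I_n -> measure_display}.
Context {E : forall i, measurableType (dE i)}.

Lemma measurable_to_product_space d (T : measurableType d)
    (g : T -> forall i, E i) : (forall i, measurable_fun [set: T] (fun w => g w i)) ->
  measurable_fun [set: T] (g : T -> product_space E).
Proof.
move=> mg; apply: (@measurability _ _ T (product_space E) setT g
  (family_events (fun i (x : forall i, E i) => x i))) => //.
move=> _ [_ [i _ [Y mY <-]] <-]; rewrite !setTI.
by rewrite -[X in measurable X]setTI; exact: mg.
Qed.

Let rectangles : set (set (product_space E)) := [set B | exists A : forall i, set (E i),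
  (forall i, measurable (A i)) /\ B = [set x | forall i, A i (x i)]].

Let rectangles_setI : setI_closed rectangles.
Proof.
move=> _ _ [A [mA ->]] [B [mB ->]]; exists (fun i => A i `&` B i); split.
  by move=> i; exact: measurableI.
apply/seteqP; split=> x /=; first by move=> [Ax Bx] i; split.
by move=> ABx; split=> i; have [] := ABx i.
Qed.

Let rectangle_measurable : rectangles `<=` measurable.
Proof.
move=> _ [A [mA ->]].
rewrite (_ : [set x | _] = \bigcap_(i in [set: 'I_n])
  ((fun x : forall i, E i => x i) @^-1` A i)); last first.
  by apply/seteqP; split=> x /= Ax i; [move=> _; exact: Ax|exact: (Ax i I)].
apply: fin_bigcap_measurable; first exact: finite_finset.
move=> i _; apply: sub_sigma_algebra; exists i => //; exists (A i) => //.
by rewrite setTI.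
Qed.

Let rectangles_generate :
  <<s family_events (fun i (x : forall i, E i) => x i) >> `<=` <<s rectangles >>.
Proof.
apply: smallest_sub; first exact: smallest_sigma_algebra.
move=> _ [i _ [Y mY <-]]; apply: sub_sigma_algebra.
have [A [mA Ai AT]] := measurable_family_at mY.
exists A; split=> //; rewrite setTI; apply/seteqP; split=> x /= => [Yx j|/(_ i)].
  by have [->|/AT->] := pselect (j = i); rewrite ?Ai.
by rewrite Ai.
Qed.

(** Full rectangles form a pi-system generating the product sigma-algebra, and the sets on which the
    two laws agree form a Dynkin system. *)
Lemma same_law_product_space d (T : measurableType d) (P : probability T R)
    (g h : T -> product_space E) :
  measurable_fun [set: T] g -> measurable_fun [set: T] h ->
  (forall A : forall i, set (E i), (forall i, measurable (A i)) ->
    P [set w | forall i, A i (g w i)] = P [set w | forall i, A i (h w i)]) ->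
  same_law P g h.
Proof.
move=> mg mh gh B /rectangles_generate.
rewrite -setI_closed_g_dynkin_g_sigma_algebra// => GB.
have m_ f : measurable_fun [set: T] (f : T -> product_space E) ->
    forall C, measurable C -> measurable (f @^-1` C).
  by move=> mf C mC; rewrite -[X in measurable X]setTI; exact: mf.
suff : <<d rectangles >> `<=`
    [set C | measurable C /\ P (g @^-1` C) = P (h @^-1` C)].
  by move=> /(_ _ GB)[].
apply: smallest_sub; last first.
  move=> C RC; split; first exact: rectangle_measurable.
  by case: RC => A [mA ->]; exact: gh.
split => /=.
- by split=> //; rewrite !preimage_setT.
- move=> A [mA e]; split; first exact: measurableC.
  apply: (etrans (probability_setC P (m_ g mg A mA))).
  apply: (etrans _ (esym (probability_setC P (m_ h mh A mA)))).
  by congr (_ - _)%E.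
- move=> F tF mF; split; first by apply: bigcup_measurable => i _; exact: (mF i).1.
  have mFi f : measurable_fun [set: T] (f : T -> product_space E) ->
      P (f @^-1` \bigcup_i F i) = (\sum_(i <oo) P (f @^-1` F i))%E.
    move=> mf; rewrite preimage_bigcup; apply: measure_semi_bigcup.
    - by move=> i; apply: (m_ f mf); exact: (mF i).1.
    - move=> i j _ _ [w [Fi Fj]]; apply: tF => //; by exists (f w).
    - by apply: bigcup_measurable => i _; apply: (m_ f mf); exact: (mF i).1.
  rewrite (mFi g mg) (mFi h mh).
  by apply: eq_eseriesr => i _; exact: (mF i).2.
Qed.

End product_space_theory.

Section pick_freeze.
Context {R : realType} {dT : measure_display} {T : measurableType dT}.
Variable P : probability T R.
Context {d k : nat} {dE : 'I_d -> measure_display}.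
Context {E : forall i, measurableType (dE i)}.
Variables (f : {mfun product_space E >-> k.-tuple R}).
Variables (X X' : forall i, {RV P >-> E i}) (v : 'I_d).
Hypothesis hindep : mutually_independent P [set~ inr v] (inputs_and_copies X X').
Hypothesis hcopy : forall i, i != v -> same_law P (X' i) (X i).
Variables Z Zv : {RV P >-> k.-tuple R}.
Hypotheses (hZ : forall w, Z w = f (fun i => X i w))
  (hZv : forall w, Zv w = f (fun i => if i == v then X i w else X' i w)).
Variable t : k.-tuple R.

Let XX (ij : 'I_d + 'I_d) : T -> E (input_index ij) := inputs_and_copies X X' ij.

Let Dv : set ('I_d + 'I_d) := [set inl v].
Let D1 : set ('I_d + 'I_d) := [set ij | if ij is inl i then i != v else false].
Let D2 : set ('I_d + 'I_d) := [set ij | if ij is inr i then i != v else false].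

Local Notation sig D := (g_sigma_algebraType (subfamily_events XX D)).

(* The input vector whose coordinate v is read off the first sample point and the
   other coordinates off the second one. *)
Definition mix d1 d2 (S1 : measurableType d1) (S2 : measurableType d2)
    (a : forall i, S1 -> E i) (b : forall i, S2 -> E i) (z : S1 * S2) (i : 'I_d) : E i :=
  if i == v then a i z.1 else b i z.2.

Lemma bmf_mix d1 d2 (S1 : measurableType d1) (S2 : measurableType d2)
    (a : forall i, S1 -> E i) (b : forall i, S2 -> E i) :
  measurable_fun [set: S1] (a v) ->
  (forall i, i != v -> measurable_fun [set: S2] (b i)) ->
  bmf (fun z => ind_le (f (mix a b z)) t).
Proof.
move=> ma mb.
apply: bmf_ind_le_comp => //.
apply: (measurableT_comp (f := f) (g := mix a b : S1 * S2 -> product_space E)) => //.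
apply: measurable_to_product_space => i; rewrite /mix.
have [->|iv] := eqVneq i v; first exact: measurableT_comp ma measurable_fst.
exact: measurableT_comp (mb _ iv) measurable_snd.
Qed.

Let h (z : T * T) := ind_le (f (mix X X z)) t.
Let h' (z : T * T) := ind_le (f (mix X X' z)) t.
Definition cond_cdf w := mean P (fun w' => ind_le (f (mix X X (w, w'))) t).
Local Notation H := cond_cdf.

Let bh : bmf h. Proof. by apply: bmf_mix. Qed.
Let bh' : bmf h'. Proof. by apply: bmf_mix. Qed.

Let hE w : h (w, w) = ind_le (Z w) t.
Proof.
rewrite hZ /h; congr (ind_le (f _) t).
by apply: functional_extensionality_dep => i; rewrite /mix; case: ifP.
Qed.

Let h'E w : h' (w, w) = ind_le (Zv w) t.
Proof. by rewrite hZv. Qed.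

(** With the coordinate v held constant, the vectors completed by the copies and by the original
    inputs have the same law, since the remaining coordinates are independent with equal
    marginals. *)
Let mean_h' w : mean P (fun w' => h' (w, w')) = H w.
Proof.
have m_ (Y : forall i, {RV P >-> E i}) :
    measurable_fun [set: T] ((fun w' => mix X Y (w, w')) : T -> product_space E).
  apply: measurable_to_product_space => i; rewrite /mix/=.
  by case: eqVneq.
have bf : bmf (fun x : product_space E => ind_le (f x) t) by exact: bmf_ind_le_comp.
rewrite /H /h'; apply: (same_law_mean (m_ X') (m_ X) _ bf).
apply: same_law_product_space => // A mA.
pose s := [seq i <- enum 'I_d | i != v].
have us : uniq s by rewrite filter_uniq// enum_uniq.
have sP i : (i \in s) = (i != v) by rewrite mem_filter mem_enum andbT.
have cyl (g : 'I_d -> 'I_d + 'I_d) : injective g -> (forall i, i != v -> g i != inr v) ->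
    P (\bigcap_(ij in [set` map g s]) (XX ij @^-1` A (input_index ij))) =
    (\prod_(i <- s) P (XX (g i) @^-1` A (input_index (g i))))%E.
  move=> gI gv; rewrite (mutually_independent_seq hindep) ?map_inj_uniq ?big_map//.
  by move=> _ /mapP[i + ->]; rewrite sP /= => /gv/eqP.
have rect (Y : forall i, {RV P >-> E i}) (w' : T) (g : 'I_d -> 'I_d + 'I_d) :
    (forall i, XX (g i) w' \in A (input_index (g i)) <-> Y i w' \in A i) -> A v (X v w) ->
    (forall i, A i (mix X Y (w, w') i)) <->
    (\bigcap_(ij in [set` map g s]) (XX ij @^-1` A (input_index ij))) w'.
  move=> gY Av; split=> [Aw _ /mapP[i + ->]|Aw i].
    rewrite sP => iv; have := Aw i; rewrite /mix (negbTE iv) => /mem_set.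
    by move=> /(gY i)/set_mem.
  rewrite /mix; have [->//|iv] := eqVneq i v.
  have /mem_set : A (input_index (g i)) (XX (g i) w').
    by apply: (Aw (g i)); apply/mapP; exists i => //; rewrite sP.
  by move=> /(gY i)/set_mem.
have [Av|nAv] := pselect (A v (X v w)); last first.
  have e (Y : forall i, {RV P >-> E i}) :
      [set w' | forall i, A i (mix X Y (w, w') i)] = set0.
    by apply/seteqP; split=> // w' /= /(_ v); rewrite /mix eqxx.
  by rewrite !e.
transitivity (\prod_(i <- s) P (X' i @^-1` A i))%E.
  rewrite -(cyl inr) => [|i j []|]//.
  congr (P _); apply/seteqP; split=> w' /=; by rewrite (rect _ w' inr).
transitivity (\prod_(i <- s) P (X i @^-1` A i))%E.
  by rewrite big_seq [RHS]big_seq; apply: eq_bigr => i; rewrite sP => iv; exact: hcopy.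
rewrite -(cyl inl) => [|i j []|]//.
congr (P _); apply/seteqP; split=> w' /=; by rewrite (rect _ w' inl).
Qed.

Let sub_measurable D : <<s subfamily_events XX D >> `<=` measurable.
Proof. exact: subfamily_events_measurable. Qed.

Let indep D D' : D `<=` [set~ inr v] -> D' `<=` [set~ inr v] -> D `&` D' = set0 ->
  independent_systems P <<s subfamily_events XX D >> <<s subfamily_events XX D' >>.
Proof. exact: mutually_independent_sigma hindep. Qed.

Let DvD : Dv `<=` [set~ inr v]. Proof. by move=> _ ->. Qed.
Let D1D : D1 `<=` [set~ inr v]. Proof. by move=> [i|i]. Qed.
Let D2D : D2 `<=` [set~ inr v].
Proof. by move=> [i|i] //= iv [e]; rewrite e eqxx in iv. Qed.

Let measurable_sig D ij : D ij -> measurable_fun [set: sig D] (XX ij).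
Proof. exact: subfamily_eventsP. Qed.

Let bH D : D (inl v) -> bmf (H : sig D -> R).
Proof.
move=> Dv'; apply: (@bmf_mean _ _ _ (sig D) T (fun z => ind_le (f (mix X X z)) t)).
by apply: bmf_mix => //; exact: (measurable_sig Dv').
Qed.

Let bH_T : bmf H.
Proof.
by apply: (@bmf_mean _ _ _ T T (fun z => ind_le (f (mix X X z)) t)); exact: bh.
Qed.

Let mean_freeze (g : T -> R) : bmf (g : sig Dv -> R) -> bmf g ->
  mean P (fun w => g w * h (w, w)) = mean P (fun w => g w * H w).
Proof.
move=> bg bgT.
have Dv1 : Dv `&` D1 = set0.
  by apply/seteqP; split=> // ij [-> /=]; rewrite eqxx.
have bgh : bmf (fun z : sig Dv * sig D1 => g z.1 * ind_le (f (mix X X z)) t).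
  apply: bmfM; first exact: bmf_comp bg measurable_fst.
  apply: bmf_mix; first exact: (@measurable_sig Dv (inl v)).
  by move=> i iv; exact: (@measurable_sig D1 (inl i)).
have := decouple (@sub_measurable _) (@sub_measurable _) (indep DvD D1D Dv1) bgh.
move=> /= e; apply: (etrans e); apply: eq_mean => w; rewrite meanZ//.
by apply: (@bmf_section1 _ _ _ T T h).
Qed.

Lemma mean_indicator : mean P (fun w => ind_le (Z w) t) = mean P H.
Proof.
under eq_mean do rewrite -hE.
have := @mean_freeze (fun=> 1) (bmf_cst 1) (bmf_cst 1).
under eq_mean do rewrite mul1r.
by under [X in _ = X -> _]eq_mean do rewrite mul1r.
Qed.

Lemma mean_indicator_copy : mean P (fun w => ind_le (Zv w) t) = mean P H.
Proof.
under eq_mean do rewrite -h'E.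
have Dv2 : Dv `&` D2 = set0 by apply/seteqP; split=> // ij [-> /=].
have bh2 : bmf (fun z : sig Dv * sig D2 => ind_le (f (mix X X' z)) t).
  apply: bmf_mix; first exact: (@measurable_sig Dv (inl v)).
  by move=> i iv; exact: (@measurable_sig D2 (inr i)).
have := decouple (@sub_measurable _) (@sub_measurable _) (indep DvD D2D Dv2) bh2.
by move=> /= e; apply: (etrans e); apply: eq_mean => w; exact: mean_h'.
Qed.

(* Given X_v, the two outputs are independent with the same conditional law. *)
Lemma mean_indicator_product :
  mean P (fun w => ind_le (Z w) t * ind_le (Zv w) t) = mean P (fun w => H w ^+ 2).
Proof.
under eq_mean do rewrite -hE -h'E.
pose Dv1 := Dv `|` D1.
have Dv1D : Dv1 `<=` [set~ inr v] by move=> ij [/DvD|/D1D].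
have D12 : Dv1 `&` D2 = set0.
  by apply/seteqP; split=> // -[i|i] [] // [|].
have b12 : bmf (fun z : sig Dv1 * sig D2 =>
    ind_le (f (mix X X (z.1, z.1))) t * ind_le (f (mix X X' z)) t).
  have mv : measurable_fun [set: sig Dv1] (X v).
    by apply: (@measurable_sig Dv1 (inl v)); left.
  apply: bmfM.
    apply: (bmf_comp (f := fun w : sig Dv1 => ind_le (f (mix X X (w, w))) t)); last first.
      exact: measurable_fst.
    apply: (bmf_comp (f := fun z : sig Dv1 * sig Dv1 => ind_le (f (mix X X z)) t)
       (g := fun w => (w, w))); last exact: measurable_fun_pair.
    apply: bmf_mix => // i iv; by apply: (@measurable_sig Dv1 (inl i)); right.
  apply: bmf_mix => // i iv; exact: (@measurable_sig D2 (inr i)).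
have := decouple (@sub_measurable _) (@sub_measurable _) (indep Dv1D D2D D12) b12.
move=> /= e; apply: (etrans e).
(* The copies are averaged first, which turns the indicator of Zv into [H]. As [H] depends on X_v
   only, [mean_freeze] then turns the indicator of Z into a second factor [H]. *)
transitivity (mean P (fun w => H w * h (w, w))).
  apply: eq_mean => w; rewrite meanZ; last exact: (@bmf_section1 _ _ _ T T h').
  by rewrite mean_h' mulrC.
by rewrite mean_freeze//; last exact: bH.
Qed.

Let bind : bmf (fun w => ind_le (Z w) t).
Proof. exact: bmf_ind_le_comp. Qed.

Let mean_set B : measurable B ->
  P ([set w | le_vec (Z w) t] `&` B) = (mean P (fun w => \1_B w * ind_le (Z w) t))%:E.
Proof.
move=> mB; rewrite -mean_indic; last exact: measurableI _ (measurable_le_vec _ _) mB.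
congr EFin; apply: eq_mean => w; rewrite setIC indicI /=.
by rewrite (indic_le_vec Z t).
Qed.

Local Notation TX := (g_sigma_algebra_preimageType (X v)).

Let sub_TX (B : set T) : g_sigma_algebra_preimage (X v) B -> measurable B.
Proof. by move=> [Y mY <-]; exact: measurable_funPT. Qed.

Let id_TX : {mfun T >-> TX}.
Proof.
refine (mfun_Sub (f := idfun : T -> TX) (mem_set _)).
by move=> _ B mB; rewrite setTI; exact: sub_TX.
Defined.

Let bH_TX : bmf (H : TX -> R).
Proof.
apply: (@bmf_mean _ _ _ TX T (fun z => ind_le (f (mix X X z)) t)).
apply: bmf_mix => //.
by move=> _ B mB; rewrite setTI; exists B => //; rewrite setTI.
Qed.

Let indic_sig (B : set T) : g_sigma_algebra_preimage (X v) B ->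
  bmf (\1_B : sig Dv -> R).
Proof.
move=> [Y mY <-]; apply: bmf_indic; rewrite setTI.
have := @measurable_sig Dv (inl v) erefl measurableT Y mY.
by rewrite setTI.
Qed.

(** Uniqueness of conditional probabilities. The comparison takes place on [T] with the
    sigma-algebra of X_v, where both functions are measurable and have the same integral over every
    event; the null set found there is also null for [P]. *)
Lemma cond_prob_version (g : T -> R) :
  is_cond_prob P [set w | le_vec (Z w) t] (X v) g ->
  ae_eq P setT (EFin \o g) (EFin \o H).
Proof.
move=> [mg ig gP].
pose mu := distribution P id_TX.
have push (u : T -> R) (B : set T) : measurable_fun [set: TX] u ->
    P.-integrable setT (EFin \o u) -> g_sigma_algebra_preimage (X v) B ->
    (\int[mu]_(w in B) (u w)%:E = \int[P]_(w in B) (u w)%:E)%E.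
  move=> mu_ iu GB.
  have := @integral_pushforward _ _ T TX R id_TX (measurable_funPT id_TX) P B
    (EFin \o u).
  apply => //; first exact/measurable_EFinP.
  by apply: integrableS iu => //; exact: sub_TX.
have : ae_eq mu setT (EFin \o g) (EFin \o H).
  apply: integral_ae_eq => //.
  - by apply: integrable_pushforward => //; exact/measurable_EFinP.
  - by apply/measurable_EFinP; have [] := bH_TX.
  move=> B _ GB; rewrite (push g)// (push H)//; last 2 first.
  - by have [] := bH_TX.
  - exact: bmf_integrable.
  have mB := sub_TX GB.
  have b1T : bmf (\1_B : T -> R) by exact: bmf_indic.
  rewrite gP// mean_set//; under eq_mean do rewrite -hE.
  rewrite (mean_freeze (indic_sig GB) b1T) meanE; last exact: bmfM.
  rewrite [RHS]integral_mkcond; apply: eq_integral => w _.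
  by rewrite /= patchE indicE; case: (w \in B); rewrite ?mul1r ?mul0r.
move=> [N [mN N0 sN]]; exists N; split=> //.
exact: sub_TX.
Qed.

(** Expansion of the square for the explicit version [H], whose first two moments are expressed by Z
    and Zv. At r = F(t) the right-hand side becomes P(Z <= t, Zv <= t) - F(t)^2. *)
Lemma second_moment_version (g : T -> R) (r : R) :
  is_cond_prob P [set w | le_vec (Z w) t] (X v) g ->
  ('E_P[fun w => ((r - g w) ^+ 2)%R])%E =
  (r ^+ 2 - 2 * r * mean P (fun w => ind_le (Z w) t) +
   mean P (fun w => ind_le (Z w) t * ind_le (Zv w) t))%:E.
Proof.
move=> hg; have [mg ig _] := hg.
have mgT : measurable_fun [set: T] g by have /measurable_EFinP := measurable_int _ ig.
have bq : bmf (fun w => (r - H w) ^+ 2).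
  by apply: bmfX; apply: bmfB => //; exact: bmf_cst.
rewrite unlock; transitivity (\int[P]_w ((r - H w) ^+ 2)%:E)%E.
  apply: ae_eq_integral => //.
  - apply/measurable_EFinP; apply: measurable_funX.
    exact: measurable_funB.
  - by apply/measurable_EFinP; have [] := bq.
  have := cond_prob_version hg; apply: filterS => w /= /(_ I) [gw] _.
  by rewrite gw.
rewrite -meanE// mean_indicator mean_indicator_product; congr EFin.
have bz : bmf (fun w => 2 * r * H w) by apply: bmfM => //; exact: bmf_cst.
transitivity (mean P (fun w => r ^+ 2 - 2 * r * H w + H w ^+ 2)).
  by apply: eq_mean => w; ring.
rewrite (meanD P (bmfB (bmf_cst (r ^+ 2)) bz) (bmfX 2 bH_T)).
by rewrite (meanB P (bmf_cst (r ^+ 2)) bz) mean_cst meanZ.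
Qed.

End pick_freeze.

(** * The estimator as a ratio of V-statistics *)

Theorem theorem3p8 (R : realType) (dT : measure_display)
    (T : measurableType dT) (P : probability T R)
    (d k : nat) (dE : 'I_d -> measure_display)
    (E : forall i, measurableType (dE i))
    (f : {mfun product_space E >-> k.-tuple R})
    (X X' : forall i, {RV P >-> E i}) (v : 'I_d)
    (Z : {RV P >-> k.-tuple R}) (Zv : {RV P >-> k.-tuple R})
    (Fv : k.-tuple R -> T -> R)
    (ZZ : nat -> {RV P >-> (k.-tuple R * k.-tuple R)%type})
    (W : nat -> {RV P >-> k.-tuple R})
    (c : R)
    (* X, and the copies X'_i for i <> v, are all independent *)
    (hindep : mutually_independent P [set~ inr v] (inputs_and_copies X X'))
    (hcopy : forall i, i != v -> same_law P (X' i) (X i))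
    (hZ : forall w, Z w = f (fun i => X i w))
    (hZv : forall w, Zv w = f (fun i => if i == v then X i w else X' i w))
    (hFv : forall t, is_cond_prob P [set w | le_vec (Z w) t] (X v) (Fv t))
    (hD : cvm_denominator Z != 0)
    (hZZ_law : forall j, same_law P (ZZ j) (fun w => (Z w, Zv w)))
    (hZZ_indep : mutually_independent P [set: nat] ZZ)
    (hW_law : forall l, same_law P (W l) Z)
    (hW_indep : mutually_independent P [set: nat] W)
    (hZZW : independent_families P ZZ W) :
  exists s : R, 0 <= s /\
    cvg_in_distribution P
      (fun N w =>
         Num.sqrt N%:R * (cvm_estimator ZZ W c N w - cvm_index Z Fv))
      (centered_gaussian s).
Proof.
pose V : measurableType _ := (k.-tuple R : measurableType _).
(* These kernels make [mean_products] and [pooled_cdf] the empirical averages of [q] and [p]. *)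
pose q (z : (V * V) * V) := ind_le z.1.1 z.2 * ind_le z.1.2 z.2.
pose p (z : (V * V) * V) := 2^-1 * (ind_le z.1.1 z.2 + ind_le z.1.2 z.2).
have bi1 : bmf (fun z : (V * V) * V => ind_le z.1.1 z.2).
  by apply: bmf_ind_le_comp => //; exact: measurableT_comp measurable_fst measurable_fst.
have bi2 : bmf (fun z : (V * V) * V => ind_le z.1.2 z.2).
  by apply: bmf_ind_le_comp => //; exact: measurableT_comp measurable_snd measurable_fst.
have bq : bmf q by exact: bmfM.
have bp : bmf p by apply: bmfM; [exact: bmf_cst|exact: bmfD].
have p01 z : 0 <= p z <= 1.
  have /andP[? ?] := ind_le01 z.1.1 z.2; have /andP[? ?] := ind_le01 z.1.2 z.2.
  by rewrite /p; apply/andP; split; lra.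
have mZZv : measurable_fun [set: T] (fun w => (Z w, Zv w)) by exact: measurable_fun_pair.
have ZZ_law j (g : V * V -> R) : bmf g ->
    mean P (fun w => g (ZZ j w)) = mean P (fun w => g (Z w, Zv w)).
  move=> bg; apply: (same_law_mean _ mZZv (hZZ_law j) bg); exact: measurable_funPT.
have W_law j (g : V -> R) : bmf g -> mean P (fun w => g (W j w)) = mean P (fun w => g (Z w)).
  move=> bg; apply: (same_law_mean _ _ (hW_law j) bg); exact: measurable_funPT.
pose F t := mean P (fun w => p (ZZ 0 w, t)).
pose G t := mean P (fun w => q (ZZ 0 w, t)).
have b_ind (t : V) (Y : {RV P >-> V}) : bmf (fun w => ind_le (Y w) t).
  exact: bmf_ind_le_comp.
(* Pooling is unbiased because Z and Zv have the same law: both distribution functions are the mean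
   of the same conditional one. *)
have FE t : F t = mean P (fun w => ind_le (Z w) t).
  apply: etrans (ZZ_law 0 (fun x => p (x, t)) (bmf_section2 bp t)) _.
  apply: etrans (meanZ P 2^-1 (bmfD (b_ind t Z) (b_ind t Zv))) _.
  rewrite (meanD P (b_ind t Z) (b_ind t Zv)).
  rewrite (mean_indicator hindep hZ) (mean_indicator_copy hindep hcopy hZv).
  lra.
have GE t : G t = mean P (fun w => ind_le (Z w) t * ind_le (Zv w) t).
  by rewrite /G (ZZ_law 0 (fun x => q (x, t)) (bmf_section2 bq t)).
have cdfE t : joint_cdf Z t = F t.
  rewrite FE -(indic_le_vec Z t) -[RHS]/(fine (mean P _)%:E) mean_indic//.
  exact: measurable_le_vec.
have mZ : measurable_fun [set: V * T] (fun z => Z z.2).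
  by apply: measurableT_comp => //; exact: measurable_snd.
have mZv : measurable_fun [set: V * T] (fun z => Zv z.2).
  by apply: measurableT_comp => //; exact: measurable_snd.
have bF : bmf F.
  rewrite (_ : F = fun t => mean P (fun w => ind_le (Z w) t)); last exact/funext.
  apply: (@bmf_mean _ _ _ V T (fun z => ind_le (Z z.2) z.1)).
  exact: bmf_ind_le_comp.
have bG : bmf G.
  rewrite (_ : G = fun t => mean P (fun w => ind_le (Z w) t * ind_le (Zv w) t)).
    apply: (@bmf_mean _ _ _ V T (fun z => ind_le (Z z.2) z.1 * ind_le (Zv z.2) z.1)).
    by apply: bmfM; exact: bmf_ind_le_comp.
  exact/funext.
pose D := mean P (fun w => F (W 0 w) * (1 - F (W 0 w))).
pose N := mean P (fun w => G (W 0 w) - F (W 0 w) ^+ 2).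
have bD : bmf (fun t : V => F t * (1 - F t)).
  by apply: bmfM => //; apply: bmfB => //; exact: bmf_cst.
have bN : bmf (fun t : V => G t - F t ^+ 2) by apply: bmfB => //; exact: bmfX.
have DE : cvm_denominator Z = D.
  rewrite /D (W_law 0 _ bD) -(mean_pushforward Z bD).
  by apply: eq_mean => t; rewrite cdfE.
have NE : cvm_numerator Z Fv = N.
  rewrite /N (W_law 0 _ bN) -(mean_pushforward Z bN); congr fine.
  apply: eq_integral => t _.
  rewrite (second_moment_version hindep hcopy hZ hZv (joint_cdf Z t) (hFv t)).
  by congr EFin; rewrite cdfE -FE -GE; ring.
have D0 : D != 0 by rewrite -DE.
have iX := mutually_independent_joint hZZ_indep hW_indep hZZW.
(* The V-statistic result takes the variables of index 0 as reference, so each law is compared with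
   that of index 0 through the law of (Z, Zv), respectively of Z. *)
have [s [s0 hs]] := vstatistic_clt iX
  (fun j g bg => etrans (ZZ_law j g bg) (esym (ZZ_law 0 g bg)))
  (fun j g bg => etrans (W_law j g bg) (esym (W_law 0 g bg))) bp bq p01 D0 c.
exists s; split => //.
suff -> : (fun N w => Num.sqrt N%:R * (cvm_estimator ZZ W c N w - cvm_index Z Fv)) =
    (fun n w => Num.sqrt n%:R * (ratio_estimator ZZ W p q c n w - N / D)) by exact: hs.
apply/funext => n; apply/funext => w; rewrite /cvm_index DE NE; congr (_ * (_ - _)).
have pooledE t : pooled_cdf (fun j => ZZ j) n w t = empirical ZZ p n w t.
  by rewrite /pooled_cdf /empirical /p -mulr_sumr/= mulrA -invfM [n%:R * 2]mulrC.
rewrite /cvm_estimator /ratio_estimator.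
have -> : cvm_den_estimator ZZ W n w = den_estimator ZZ W p n w.
  by congr (_ * _); apply: eq_bigr => l _; rewrite pooledE.
have -> // : cvm_num_estimator ZZ W n w = num_estimator ZZ W p q n w.
by congr (_ * _); apply: eq_bigr => l _; rewrite pooledE.
Qed.
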